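(* Let $J\in\mathbb{C}^{2\times2}$ be unitary, with associated coefficients $\omega_\pm$, $\mu_\pm^{(x,y)}$, $\mu_0^{(x,y)}$ and Green's function $G$ (defined in the context). For every $k\in\mathbb{R}\setminus\{0\}$ the solution $\Psi(t,x;e^{ik\,\cdot\,})=\int_{\mathbb{R}}G(t,x,y)e^{iky}\,dy$ of the Schrödinger equation with generalized point interaction given by $J$ and initial condition $F(x)=e^{ikx}$ admits, for $x\in\mathbb{R}\setminus\{0\}$, the long time asymptotics $$\begin{aligned}\Psi(t,x;e^{ik\,\cdot\,})=&\,e^{ikx-ik^2t}+2\left(\frac{\mu_+^{(x,-k)}}{\omega_+-i|k|}+\frac{\mu_-^{(x,-k)}}{\omega_--i|k|}+\frac{\mu_0^{(x,-k)}}{2}\right)e^{i|kx|-ik^2t}\\&-\sum_{j=\pm}\left(\frac{\mu_j^{(x,0^-)}}{\omega_j-ik}+\frac{\mu_j^{(x,0^+)}}{\omega_j+ik}\right)2\Theta(-\omega_j)e^{\omega_j|x|+i\omega_j^2t}+\mathcal{O}\Big(\frac{1}{\sqrt t}\Big),\qquad t\to\infty.\end{aligned}$$ Moreover, for $k=0$, $$\begin{aligned}\Psi(t,x;1)=&\,\frac{\mu_+^{(x,0^+)}+\mu_+^{(x,0^-)}}{\omega_+}+\frac{\mu_-^{(x,0^+)}+\mu_-^{(x,0^-)}}{\omega_-}+\frac{\mu_0^{(x,0^+)}+\mu_0^{(x,0^-)}}{2}+1\\&-\sum_{j=\pm}\frac{\mu_j^{(x,0^-)}+\mu_j^{(x,0^+)}}{\omega_j}\,2\Theta(-\omega_j)e^{\omega_j|x|+i\omega_j^2t}+\mathcal{O}\Big(\frac{1}{\sqrt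 t}\Big),\qquad t\to\infty,\end{aligned}$$ where the last formula is understood in the sense that $\mu_j^{(x,0^\pm)}/\omega_j=0$ whenever $\omega_j=0$.
   Context: Conventions: for $t>0$, $\sqrt{it}=e^{i\pi/4}\sqrt t$ and $\sqrt{i\pi t}=e^{i\pi/4}\sqrt{\pi t}$ (principal branch); $\Theta(x)=1$ for $x>0$ and $\Theta(x)=0$ for $x<0$ (whenever $\omega_j=0$ one has $\mu_j^{(x,y)}=0$, and the terms containing $\Theta(-\omega_j)$ are read as $0$). The $\mathcal{O}$-terms are for fixed $x$ and $k$. The entire function $\Lambda$ is $\Lambda(z)=e^{z^2}(1-\operatorname{erf}(z))$, where $\operatorname{erf}(z)=\frac{2}{\sqrt\pi}\int_0^z e^{-\xi^2}d\xi$. Coefficients. Every unitary $J\in\mathbb{C}^{2\times2}$ has the form $J=e^{i\phi}\begin{pmatrix}\alpha&-\bar\beta\\ \beta&\bar\alpha\end{pmatrix}$ with $\phi\in[0,\pi)$, $\alpha,\beta\in\mathbb{C}$ and $|\alpha|^2+|\beta|^2=1$. For $x,y\in\mathbb{R}\setminus\{0\}$ put $\eta^{(x,y)}=0$ if $|\operatorname{Re}(\alpha)|=1$, and if $|\operatorname{Re}(\alpha)|\neq1$ put $$\eta^{(x,y)}=\frac{1}{\sqrt{1-\operatorname{Re}(\alpha)^2}}\cdot\begin{cases}-\operatorname{Im}(\alpha),&x,y>0,\\ -i\bar\beta,&x>0,\,y<0,\\ i\beta,&x<0,\,y>0,\\ \operatorname{Im}(\alpha),&x,y<0.\end{cases}$$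 Case I: if $\operatorname{Re}(\alpha)\neq-\cos(\phi)$, then $\omega_\pm=\frac{-\sin(\phi)\pm\sqrt{1-\operatorname{Re}(\alpha)^2}}{\cos(\phi)+\operatorname{Re}(\alpha)}$, $\mu_\pm^{(x,y)}=-\frac{\omega_\pm}{2}\big(\Theta(xy)\pm\eta^{(x,y)}\big)$, $\mu_0^{(x,y)}=\operatorname{sgn}(xy)$. Case II: if $\operatorname{Re}(\alpha)=-\cos(\phi)\neq-1$, then $\omega_-=\mu_-^{(x,y)}=0$, $\omega_+=\cot(\phi)$, $\mu_+^{(x,y)}=-\frac{\omega_+}{2}\big(\Theta(xy)+\eta^{(x,y)}\big)$, $\mu_0^{(x,y)}=\eta^{(x,y)}-\Theta(-xy)$. Case III: if $\operatorname{Re}(\alpha)=-\cos(\phi)=-1$, then $\omega_\pm=\mu_\pm^{(x,y)}=0$ and $\mu_0^{(x,y)}=-1$. These coefficients depend on $x,y$ only through their signs; $\mu_j^{(x,0^+)}$ (resp. $\mu_j^{(x,0^-)}$), $j\in\{0,+,-\}$, denotes the value of $\mu_j^{(x,y)}$ for $y>0$ (resp. $y<0$), and $\mu_j^{(x,-k)}$ is $\mu_j^{(x,y)}$ at $y=-k$. Green's function: for $t>0$, $x,y\in\mathbb{R}\setminus\{0\}$, $$G(t,x,y)=\Big(\mu_+^{(x,y)}\Lambda\Big(\tfrac{|x|+|y|}{2\sqrt{it}}+\omega_+\sqrt{it}\Big)+\mu_-^{(x,y)}\Lambda\Big(\tfrac{|x|+|y|}{2\sqrt{it}}+\omega_-\sqrt{it}\Big)\Big)e^{-\frac{(|x|+|y|)^2}{4it}}+\frac{1}{2\sqrt{i\pi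 t}}\Big(\mu_0^{(x,y)}e^{-\frac{(|x|+|y|)^2}{4it}}+e^{-\frac{(x-y)^2}{4it}}\Big).$$ Solution: ''the solution'' with initial condition $F$ means $$\Psi(t,x;F)=\int_{\mathbb{R}}G(t,x,y)F(y)\,dy:=\lim_{R_1\to\infty}\int_{-R_1}^0G(t,x,y)F(y)\,dy+\lim_{R_2\to\infty}\int_0^{R_2}G(t,x,y)F(y)\,dy$$ (improper Riemann integrals, which exist for $F(y)=e^{iky}$); it solves $i\partial_t\Psi=-\partial_x^2\Psi$ for $t>0$, $x\neq0$, with $(I-J)(\Psi(t,0^+),\Psi(t,0^-))^T=i(I+J)(\partial_x\Psi(t,0^+),-\partial_x\Psi(t,0^-))^T$ and $\Psi(0^+,x)=F(x)$. *)

(* Defs.v *)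
From Stdlib Require Import Reals Lra.
From Coquelicot Require Import Coquelicot.
Open Scope R_scope.

Definition Cexp (z : C) : C :=
  (exp (Re z) * cos (Im z), exp (Re z) * sin (Im z)).

(* The line integral from 0 to z is taken along the segment xi = s z,
   0 <= s <= 1; the integrand is entire, so the path is irrelevant. *)
Definition Cerf (z : C) : C :=
  (2 / sqrt PI *
   RInt (V := C_R_CompleteNormedModule)
     (fun s : R => Cexp (- (s * z) ^ 2) * z) 0 1)%C.

Definition Lambda (z : C) : C := (Cexp (z ^ 2) * (1 - Cerf z))%C.

(* Principal branches, for t > 0. *)
Definition sqrt_it (t : R) : C := (Cexp (Ci * (PI / 4)) * sqrt t)%C.
Definition sqrt_ipit (t : R) : C := (Cexp (Ci * (PI / 4)) * sqrt (PI * t))%C.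

(* Only Theta 0 is a convention: with Theta 0 = 0, the terms containing
   Theta (- omega_j) vanish when omega_j = 0. *)
Definition Theta (x : R) : R := if Rlt_dec 0 x then 1 else 0.

Definition adjoint (J : @matrix C 2 2) : @matrix C 2 2 :=
  mk_matrix 2 2 (fun i j => Cconj (coeff_mat (RtoC 0) J j i)).

Definition unitary (J : @matrix C 2 2) : Prop :=
  Mmult (T := C_Ring) (adjoint J) J = Mone.

Definition parametrizes (phi : R) (alpha beta : C) (J : @matrix C 2 2) : Prop :=
  0 <= phi < PI /\
  Cmod alpha ^ 2 + Cmod beta ^ 2 = 1 /\
  J = [ [ (Cexp (Ci * phi) * alpha)%C, (Cexp (Ci * phi) * - Cconj beta)%C ],
        [ (Cexp (Ci * phi) * beta)%C, (Cexp (Ci * phi) * Cconj alpha)%C ] ].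

Lemma circle_angle u v : u ^ 2 + v ^ 2 = 1 ->
  exists phi, 0 <= phi < PI /\ cos (2 * phi) = u /\ sin (2 * phi) = v.
Proof.
intros H.
assert (Hu : -1 <= u <= 1) by nra.
assert (Hs : sqrt (1 - u²) = Rabs v).
{ replace (1 - u²) with (v²) by (unfold Rsqr; nra). apply sqrt_Rsqr_abs. }
pose proof (acos_bound u) as Hb. pose proof PI_RGT_0.
destruct (Rle_dec 0 v) as [Hv|Hv].
- exists (acos u / 2). replace (2 * (acos u / 2)) with (acos u) by lra.
  rewrite cos_acos, sin_acos, Hs, Rabs_right by lra.
  repeat split; lra.
- exists (PI - acos u / 2).
  assert (acos u <> 0).
  { intro E. assert (sin (acos u) = 0) by (rewrite E; apply sin_0).
    rewrite sin_acos, Hs, Rabs_left in H1 by lra. lra. }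
  replace (2 * (PI - acos u / 2)) with (- acos u + 2 * PI) by lra.
  rewrite cos_plus, sin_plus, cos_2PI, sin_2PI, cos_neg, sin_neg,
    cos_acos, sin_acos, Hs, Rabs_left by lra.
  repeat split; lra.
Qed.


(* So quantifying over the parameters of J omits no unitary J. *)
Lemma unitary_parametrizes (J : @matrix C 2 2) : unitary J ->
  exists phi alpha beta, parametrizes phi alpha beta J.
Proof.
destruct J as [[[a1 a2] [[b1 b2] []]] [[[c1 c2] [[d1 d2] []]] []]].
intros HJ.
assert (H := fun i j => f_equal (fun M => coeff_mat (RtoC 0) M i j) HJ).
unfold unitary, adjoint, Mmult, Mone in H.
assert (H00 := H 0%nat 0%nat). assert (H01 := H 0%nat 1%nat).
assert (H11 := H 1%nat 1%nat). clear H HJ.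
cbn in H00, H01, H11. unfold sum_n, sum_n_m, Iter.iter_nat, Iter.iter in *.
cbn in *. 
unfold plus, mult, one, zero, Cconj in *. cbn in *. unfold coeff_mat, Cplus, Cmult in *. cbn in *.
injection H00 as A1 A2. injection H01 as B1 B2. injection H11 as D1 D2.
set (u := a1 * d1 - a2 * d2 - b1 * c1 + b2 * c2).
set (v := a1 * d2 + a2 * d1 - b1 * c2 - b2 * c1).
assert (P : a1 * b1 + a2 * b2 + c1 * d1 + c2 * d2 = 0) by lra.
assert (Q : a1 * b2 - a2 * b1 + c1 * d2 - c2 * d1 = 0) by lra.
assert (N : a1 ^ 2 + a2 ^ 2 + c1 ^ 2 + c2 ^ 2 = 1) by lra.
assert (N' : b1 ^ 2 + b2 ^ 2 + d1 ^ 2 + d2 ^ 2 = 1) by lra.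
destruct (circle_angle u v) as (phi & Hphi & Hu & Hv).
{ replace (u ^ 2 + v ^ 2) with
    ((a1 ^ 2 + a2 ^ 2 + c1 ^ 2 + c2 ^ 2) * (b1 ^ 2 + b2 ^ 2 + d1 ^ 2 + d2 ^ 2)
     - (a1 * b1 + a2 * b2 + c1 * d1 + c2 * d2) ^ 2
     - (a1 * b2 - a2 * b1 + c1 * d2 - c2 * d1) ^ 2) by (unfold u, v; ring).
  rewrite P, Q, N, N'; ring. }
rewrite cos_2a in Hu. rewrite sin_2a in Hv.
assert (E : sin phi * sin phi + cos phi * cos phi = 1) by apply (sin2_cos2 phi).
assert (Eb1 : b1 = - (u * c1 + v * c2)).
{ transitivity (b1 * (a1 ^ 2 + a2 ^ 2 + c1 ^ 2 + c2 ^ 2)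
    - a1 * (a1 * b1 + a2 * b2 + c1 * d1 + c2 * d2)
    + a2 * (a1 * b2 - a2 * b1 + c1 * d2 - c2 * d1)).
  - rewrite P, Q, N; ring.
  - unfold u, v; ring. }
assert (Eb2 : b2 = - (v * c1 - u * c2)).
{ transitivity (b2 * (a1 ^ 2 + a2 ^ 2 + c1 ^ 2 + c2 ^ 2)
    - a2 * (a1 * b1 + a2 * b2 + c1 * d1 + c2 * d2)
    - a1 * (a1 * b2 - a2 * b1 + c1 * d2 - c2 * d1)).
  - rewrite P, Q, N; ring.
  - unfold u, v; ring. }
assert (Ed1 : d1 = u * a1 + v * a2).
{ transitivity (d1 * (a1 ^ 2 + a2 ^ 2 + c1 ^ 2 + c2 ^ 2)
    - c1 * (a1 * b1 + a2 * b2 + c1 * d1 + c2 * d2)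
    + c2 * (a1 * b2 - a2 * b1 + c1 * d2 - c2 * d1)).
  - rewrite P, Q, N; ring.
  - unfold u, v; ring. }
assert (Ed2 : d2 = v * a1 - u * a2).
{ transitivity (d2 * (a1 ^ 2 + a2 ^ 2 + c1 ^ 2 + c2 ^ 2)
    - c2 * (a1 * b1 + a2 * b2 + c1 * d1 + c2 * d2)
    - c1 * (a1 * b2 - a2 * b1 + c1 * d2 - c2 * d1)).
  - rewrite P, Q, N; ring.
  - unfold u, v; ring. }
clearbody u v. subst u v.
exists phi, (cos phi * a1 + sin phi * a2, cos phi * a2 - sin phi * a1),
  (cos phi * c1 + sin phi * c2, cos phi * c2 - sin phi * c1).
clear - Hphi N E Eb1 Eb2 Ed1 Ed2.
set (C := cos phi) in *. set (S := sin phi) in *.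
split; [exact Hphi|split].
- rewrite !Cmod2_alt. cbn [Re Im fst snd].
  replace 1 with ((S * S + C * C) * (a1 ^ 2 + a2 ^ 2 + c1 ^ 2 + c2 ^ 2))
    by (rewrite E, N; ring).
  ring.
- assert (Ec : Cexp (Ci * phi) = (C, S)).
  { unfold Cexp. cbn [Re Im fst snd Cmult Ci RtoC].
    replace (0 * phi - 1 * 0) with 0 by ring.
    replace (0 * 0 + 1 * phi) with phi by ring.
    rewrite exp_0. fold C S. f_equal; ring. }
  rewrite Ec. unfold Cmult, Copp, Cconj. cbn [fst snd].
  repeat f_equal; rewrite ?Eb1, ?Eb2, ?Ed1, ?Ed2; try ring.
  + transitivity ((S * S + C * C) * a1); [rewrite E|]; ring.
  + transitivity ((S * S + C * C) * a2); [rewrite E|]; ring.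
  + transitivity ((S * S + C * C) * c1); [rewrite E|]; ring.
  + transitivity ((S * S + C * C) * c2); [rewrite E|]; ring.
Qed.

(* The values at x = 0 or y = 0 are junk and never matter. *)
Definition eta (alpha beta : C) (x y : R) : C :=
  if Req_EM_T (Rabs (Re alpha)) 1 then RtoC 0
  else
    (/ sqrt (1 - Re alpha ^ 2) *
     (if Rlt_dec 0 x
      then if Rlt_dec 0 y then - Im alpha else - Ci * Cconj beta
      else if Rlt_dec 0 y then Ci * beta else Im alpha))%C.

Inductive branch : Set := plus_br | minus_br.

Definition pm (j : branch) : R :=
  match j with plus_br => 1 | minus_br => -1 end.

Record coefficients := Coefficients {
  omega : branch -> R;
  mu : branch -> R -> R -> C;
  mu0 : R -> R -> C
}.

Definition omega_I (phi : R) (alpha : C) (j : branch) : R :=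
  (- sin phi + pm j * sqrt (1 - Re alpha ^ 2)) / (cos phi + Re alpha).

Definition coefs_I (phi : R) (alpha beta : C) : coefficients := {|
  omega := omega_I phi alpha;
  mu j x y :=
    (- (omega_I phi alpha j / 2) * (Theta (x * y) + pm j * eta alpha beta x y))%C;
  mu0 x y := RtoC (sign (x * y))
|}.

Definition coefs_II (phi : R) (alpha beta : C) : coefficients := {|
  omega j := match j with plus_br => cos phi / sin phi | minus_br => 0 end;
  mu j x y :=
    match j with
    | plus_br =>
        (- (cos phi / sin phi / 2) * (Theta (x * y) + eta alpha beta x y))%C
    | minus_br => RtoC 0
    end;
  mu0 x y := (eta alpha beta x y - Theta (- (x * y)))%C
|}.

Definition coefs_III : coefficients := {|
  omega _ := 0;
  mu _ _ _ := RtoC 0;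
  mu0 _ _ := RtoC (-1)
|}.

Definition coefs (phi : R) (alpha beta : C) : coefficients :=
  if Req_EM_T (Re alpha) (- cos phi) then
    if Req_EM_T (- cos phi) (-1) then coefs_III else coefs_II phi alpha beta
  else coefs_I phi alpha beta.

(* mu_j^{(x,0^+)}, mu_j^{(x,0^-)}: only the sign of y matters, so the
   one-sided values are read off at y = 1 and y = -1. *)
Definition mu_0p (c : coefficients) (j : branch) (x : R) : C := mu c j x 1.
Definition mu_0m (c : coefficients) (j : branch) (x : R) : C := mu c j x (-1).
Definition mu0_0p (c : coefficients) (x : R) : C := mu0 c x 1.
Definition mu0_0m (c : coefficients) (x : R) : C := mu0 c x (-1).

Definition G (c : coefficients) (t x y : R) : C :=
  let a := Rabs x + Rabs y in
  let L j := Lambda (a / (2 * sqrt_it t) + omega c j * sqrt_it t)%C in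
  ((mu c plus_br x y * L plus_br + mu c minus_br x y * L minus_br)
     * Cexp (- (a ^ 2 / (4 * Ci * t)))
   + 1 / (2 * sqrt_ipit t) *
     (mu0 c x y * Cexp (- (a ^ 2 / (4 * Ci * t)))
      + Cexp (- ((x - y) ^ 2 / (4 * Ci * t)))))%C.

Definition ex_Psi (c : coefficients) (F : R -> C) (t x : R) : Prop :=
  ex_RInt_gen (V := C_R_NormedModule)
    (fun y => G c t x y * F y)%C (Rbar_locally m_infty) (at_point 0) /\
  ex_RInt_gen (V := C_R_NormedModule)
    (fun y => G c t x y * F y)%C (at_point 0) (Rbar_locally p_infty).

Definition Psi (c : coefficients) (F : R -> C) (t x : R) : C :=
  (RInt_gen (V := C_R_CompleteNormedModule)
     (fun y => G c t x y * F y) (Rbar_locally m_infty) (at_point 0) +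
   RInt_gen (V := C_R_CompleteNormedModule)
     (fun y => G c t x y * F y) (at_point 0) (Rbar_locally p_infty))%C.

Definition O_inv_sqrt (f : R -> C) : Prop :=
  exists M : R, Rbar_locally p_infty (fun t => Cmod (f t) <= M / sqrt t).

Definition sum_pm (f : branch -> C) : C := (f plus_br + f minus_br)%C.

(* The k = 0 formula sets mu_j / omega_j = 0 whenever omega_j = 0. *)
Definition quot0 (m : C) (w : R) : C :=
  if Req_EM_T w 0 then RtoC 0 else (m / w)%C.

(* Main.v *)
Require Import Defs.
From Stdlib Require Import Reals Lra.
From Coquelicot Require Import Coquelicot.
Open Scope R_scope.

(** Everything is explicit. For fixed t put s = sqrt (i t) and, for a complex
number kappa and a real number a, consider the modulated error function
  wave t kappa a = exp (kappa a + i kappa^2 t) (1 - erf (a / (2 s) + kappa s)).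
Completing the square shows that it equals Lambda (a / (2 s) + kappa s) times
the chirp exp (- a^2 / (4 i t)) ([wave_Lambda]), so the Green's function is a
combination of the waves with kappa = omega_j and of chirps ([G_eq]). Since
  d/da wave t kappa a = kappa wave t kappa a - chirp t a / sqrt (i pi t),
the products of waves and chirps with exp (i k y) have primitives of the same
kind: that of wave t omega is (wave t omega - wave t (- i k)) / (omega + i k)
times exp (i k y), and that of the chirp is a multiple of wave t (- i k) times
exp (i k y). These primitives vanish at infinity, hence the improper integrals
exist and are given by the values of waves at y = 0. On both half lines
together the chirp of x - y contributes two waves that reflection of erf
combines into exactly exp (i k x - i k^2 t) ([Psi_plane_wave]).

Both the vanishing at infinity and the behaviour for large t follow from one
estimate, |Lambda z| <= 1 / Re z for Re z > 0 ([Cmod_Lambda_le]). The real part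
of a / (2 s) + kappa s is a / (4 r) + (Re kappa - Im kappa) r with
r = sqrt (t / 2). It grows like sqrt t if Re kappa > Im kappa, and then the wave
is O (1 / sqrt t). If Re kappa < Im kappa, the reflection
erf (- z) = - erf z turns the wave into 2 exp (kappa a + i kappa^2 t) minus a
decaying one. For kappa = omega_j this produces the terms with Theta (- omega_j),
for kappa = - i k and i k the reflected or transmitted plane wave, according
to the sign of k; for kappa = 0 the wave tends to 1.

The estimate for Lambda comes from integrating exp (z^2 - (z + r)^2) over
r >= 0. It needs erf (z + r) to tend to 1, which reduces to the Gaussian
integral on the real axis; this in turn is the conservation law
  erf (u)^2 + (4 / pi) int_0^1 exp (- u^2 (1 + v^2)) / (1 + v^2) dv = 1. *)

(** * Calculus for complex functions of a real variable *)

Notation is_Cderive := (@is_derive R_AbsRing C_R_NormedModule).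
Notation Ccontinuous := (@continuous _ C_R_NormedModule).

Lemma is_Cderive_pair (f g : R -> R) (x a b : R) :
  is_derive f x a -> is_derive g x b ->
  is_Cderive (fun u => (f u, g u)) x (a, b).
Proof.
intros Hf Hg.
apply (is_derive_ext (V := C_R_NormedModule)
  (fun u => plus (scal (f u) ((1, 0) : C_R_NormedModule))
                 (scal (g u) ((0, 1) : C_R_NormedModule)))).
- intros u. unfold plus, scal; simpl. unfold prod_plus, prod_scal, plus, scal; simpl.
  unfold mult; simpl. f_equal; ring.
- replace ((a, b) : C) with
    (plus (scal a ((1, 0) : C_R_NormedModule)) (scal b ((0, 1) : C_R_NormedModule))).
  2:{ unfold plus, scal; simpl. unfold prod_plus, prod_scal, plus, scal; simpl.
      unfold mult; simpl. f_equal; ring. }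
  apply (is_derive_plus (V := C_R_NormedModule));
    apply (is_derive_scal_l (V := C_R_NormedModule)); assumption.
Qed.

Lemma is_Cderive_Re (f : R -> C) (x : R) (l : C) :
  is_Cderive f x l -> is_derive (fun u => Re (f u)) x (Re l).
Proof.
intros H.
refine (filterdiff_ext_lin _ _ _ (filterdiff_comp' (V := C_R_NormedModule) f
  (fun z : C => Re z) x _ _ H (filterdiff_linear _ _)) _).
- apply (@is_linear_fst R_AbsRing R_NormedModule R_NormedModule).
- reflexivity.
Qed.

Lemma is_Cderive_Im (f : R -> C) (x : R) (l : C) :
  is_Cderive f x l -> is_derive (fun u => Im (f u)) x (Im l).
Proof.
intros H.
refine (filterdiff_ext_lin _ _ _ (filterdiff_comp' (V := C_R_NormedModule) f
  (fun z : C => Im z) x _ _ H (filterdiff_linear _ _)) _).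
- apply (@is_linear_snd R_AbsRing R_NormedModule R_NormedModule).
- reflexivity.
Qed.

Lemma is_Cderive_val (f : R -> C) (x : R) (l l' : C) :
  is_Cderive f x l -> l = l' -> is_Cderive f x l'.
Proof. intros H <-; exact H. Qed.

Lemma is_Cderive_const (c : C) (x : R) : is_Cderive (fun _ => c) x (RtoC 0).
Proof. exact (is_derive_const (V := C_R_NormedModule) c x). Qed.

Lemma is_Cderive_plus (f g : R -> C) x df dg :
  is_Cderive f x df -> is_Cderive g x dg ->
  is_Cderive (fun u => f u + g u)%C x (df + dg)%C.
Proof. exact (is_derive_plus (V := C_R_NormedModule) f g x df dg). Qed.

Lemma is_Cderive_opp (f : R -> C) x df :
  is_Cderive f x df -> is_Cderive (fun u => - f u)%C x (- df)%C.
Proof. exact (is_derive_opp (V := C_R_NormedModule) f x df). Qed.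

Lemma is_Cderive_minus (f g : R -> C) x df dg :
  is_Cderive f x df -> is_Cderive g x dg ->
  is_Cderive (fun u => f u - g u)%C x (df - dg)%C.
Proof. intros Hf Hg. apply is_Cderive_plus, is_Cderive_opp; assumption. Qed.

Lemma is_Cderive_mult (f g : R -> C) x df dg :
  is_Cderive f x df -> is_Cderive g x dg ->
  is_Cderive (fun u => f u * g u)%C x (df * g x + f x * dg)%C.
Proof.
intros Hf Hg.
pose proof (is_Cderive_Re _ _ _ Hf) as H1. pose proof (is_Cderive_Im _ _ _ Hf) as H2.
pose proof (is_Cderive_Re _ _ _ Hg) as H3. pose proof (is_Cderive_Im _ _ _ Hg) as H4.
eapply is_Cderive_val.
- apply is_Cderive_pair.
  + exact (is_derive_minus _ _ _ _ _
      (is_derive_mult _ _ _ _ _ H1 H3 Rmult_comm) (is_derive_mult _ _ _ _ _ H2 H4 Rmult_comm)).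
  + exact (is_derive_plus _ _ _ _ _
      (is_derive_mult _ _ _ _ _ H1 H4 Rmult_comm) (is_derive_mult _ _ _ _ _ H2 H3 Rmult_comm)).
- unfold minus, plus, opp, mult, Cplus, Cmult, Re, Im; simpl. f_equal; ring.
Qed.

Lemma is_Cderive_RtoC (f : R -> R) x l :
  is_derive f x l -> is_Cderive (fun u => RtoC (f u)) x (RtoC l).
Proof. intros H. apply is_Cderive_pair; [exact H|exact (is_derive_const 0 x)]. Qed.

Lemma is_Cderive_id x : is_Cderive (fun u => RtoC u) x (RtoC 1).
Proof. apply (is_Cderive_RtoC (fun u => u)), (is_derive_id (K := R_AbsRing)). Qed.

Lemma is_Cderive_Cexp (f : R -> C) x l :
  is_Cderive f x l -> is_Cderive (fun u => Cexp (f u)) x (l * Cexp (f x))%C.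
Proof.
intros H.
pose proof (is_Cderive_Re _ _ _ H) as H1. pose proof (is_Cderive_Im _ _ _ H) as H2.
pose proof (is_derive_comp exp (fun u => Re (f u)) x _ _ (is_derive_exp _) H1) as He.
pose proof (is_derive_comp cos (fun u => Im (f u)) x _ _ (is_derive_cos _) H2) as Hc.
pose proof (is_derive_comp sin (fun u => Im (f u)) x _ _ (is_derive_sin _) H2) as Hs.
eapply is_Cderive_val.
- apply is_Cderive_pair.
  + exact (is_derive_mult _ _ _ _ _ He Hc Rmult_comm).
  + exact (is_derive_mult _ _ _ _ _ He Hs Rmult_comm).
- unfold plus, mult, scal, Cmult; simpl. unfold mult, Re, Im; simpl. f_equal; ring.
Qed.

Lemma is_Cderive_continuous (f : R -> C) x l : is_Cderive f x l -> Ccontinuous f x.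
Proof. intros H. apply (ex_derive_continuous (V := C_R_NormedModule)). exists l. exact H. Qed.

Lemma Ccontinuous_pair {U : UniformSpace} (f g : U -> R) x :
  continuous f x -> continuous g x -> Ccontinuous (fun u => (f u, g u)) x.
Proof.
intros Hf Hg.
apply (continuous_comp_2 (W := R_UniformSpace) (V := R_UniformSpace) (X := C_R_NormedModule)
  f g (fun a b => (a, b)) x Hf Hg).
apply continuous_ext with (f := fun z => z); [now intros []|apply continuous_id].
Qed.

Lemma Ccontinuous_Re {U : UniformSpace} (f : U -> C) x :
  Ccontinuous f x -> continuous (fun u => Re (f u)) x.
Proof. intros H. apply (continuous_comp f fst); [exact H|apply continuous_fst]. Qed.

Lemma Ccontinuous_Im {U : UniformSpace} (f : U -> C) x :
  Ccontinuous f x -> continuous (fun u => Im (f u)) x.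
Proof. intros H. apply (continuous_comp f snd); [exact H|apply continuous_snd]. Qed.

Lemma Ccontinuous_mult {U : UniformSpace} (f g : U -> C) x :
  Ccontinuous f x -> Ccontinuous g x -> Ccontinuous (fun u => f u * g u)%C x.
Proof.
intros Hf Hg.
pose proof (Ccontinuous_Re _ _ Hf). pose proof (Ccontinuous_Im _ _ Hf).
pose proof (Ccontinuous_Re _ _ Hg). pose proof (Ccontinuous_Im _ _ Hg).
apply Ccontinuous_pair.
- apply (continuous_minus (V := R_NormedModule)); apply (continuous_mult (K := R_AbsRing)); assumption.
- apply (continuous_plus (V := R_NormedModule)); apply (continuous_mult (K := R_AbsRing)); assumption.
Qed.

Lemma Ccontinuous_Cexp {U : UniformSpace} (f : U -> C) x :
  Ccontinuous f x -> Ccontinuous (fun u => Cexp (f u)) x.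
Proof.
intros Hf.
pose proof (Ccontinuous_Re _ _ Hf). pose proof (Ccontinuous_Im _ _ Hf).
apply Ccontinuous_pair; apply (continuous_mult (K := R_AbsRing)).
- apply (continuous_comp _ exp); [assumption|apply continuous_exp].
- apply (continuous_comp _ cos); [assumption|apply continuous_cos].
- apply (continuous_comp _ exp); [assumption|apply continuous_exp].
- apply (continuous_comp _ sin); [assumption|apply continuous_sin].
Qed.

Lemma Ccontinuous_plus {U : UniformSpace} (f g : U -> C) x :
  Ccontinuous f x -> Ccontinuous g x -> Ccontinuous (fun u => f u + g u)%C x.
Proof. exact (continuous_plus (V := C_R_NormedModule) f g x). Qed.

Lemma Ccontinuous_opp {U : UniformSpace} (f : U -> C) x :
  Ccontinuous f x -> Ccontinuous (fun u => - f u)%C x.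
Proof. exact (continuous_opp (V := C_R_NormedModule) f x). Qed.

Lemma Ccontinuous_RtoC {U : UniformSpace} (f : U -> R) x :
  continuous f x -> Ccontinuous (fun u => RtoC (f u)) x.
Proof. intros H. apply Ccontinuous_pair; [exact H|apply continuous_const]. Qed.

(** Componentwise reduction to differentiation under a real integral sign. *)
Lemma Cderive_RInt_param (f df : R -> R -> C) :
  (forall u s, is_Cderive (fun v => f v s) u (df u s)) ->
  (forall u s, Ccontinuous (fun p : R * R => df (fst p) (snd p)) (u, s)) ->
  (forall u s, Ccontinuous (f u) s) ->
  forall u, is_Cderive (fun v => RInt (V := C_R_CompleteNormedModule) (f v) 0 1) u
    (RInt (V := C_R_CompleteNormedModule) (df u) 0 1).
Proof.
intros Hd Hc Hf u.
assert (Hsplit : forall g : R -> C, (forall s, Ccontinuous g s) ->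
  RInt (V := C_R_CompleteNormedModule) g 0 1
  = (RInt (fun s => Re (g s)) 0 1, RInt (fun s => Im (g s)) 0 1)).
{ intros g Hg. apply is_RInt_unique.
  apply (is_RInt_fct_extend_pair (U := R_NormedModule) (V := R_NormedModule));
    apply (RInt_correct (V := R_CompleteNormedModule));
    apply (ex_RInt_continuous (V := R_CompleteNormedModule)); intros s _.
  - now apply Ccontinuous_Re.
  - now apply Ccontinuous_Im. }
assert (Hdc : forall v s, Ccontinuous (df v) s).
{ intros v s.
  apply (continuous_comp_2 (V := R_UniformSpace) (W := R_UniformSpace)
    (X := C_R_NormedModule) (fun _ => v) (fun s => s) df);
    [apply continuous_const|apply continuous_id|apply Hc]. }
apply (is_derive_ext (V := C_R_NormedModule)
  (fun v => (RInt (fun s => Re (f v s)) 0 1, RInt (fun s => Im (f v s)) 0 1))).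
{ intros v. now rewrite Hsplit. }
rewrite Hsplit by apply Hdc.
assert (DR : forall v s, is_derive (fun v => Re (f v s)) v (Re (df v s))).
{ intros v s. apply (is_Cderive_Re (fun v => f v s)), Hd. }
assert (DI : forall v s, is_derive (fun v => Im (f v s)) v (Im (df v s))).
{ intros v s. apply (is_Cderive_Im (fun v => f v s)), Hd. }
apply is_Cderive_pair.
- rewrite (RInt_ext _ (fun s => Derive (fun v => Re (f v s)) u))
    by (intros; symmetry; apply is_derive_unique, DR).
  apply is_derive_RInt_param.
  + exists (mkposreal 1 Rlt_0_1). intros v _ s _. eexists; apply DR.
  + intros s _. apply continuity_2d_pt_ext with (fun v s => Re (df v s)).
    { intros; symmetry; apply is_derive_unique, DR. }
    apply continuity_2d_pt_filterlim, (Ccontinuous_Re _ _ (Hc u s)).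
  + exists (mkposreal 1 Rlt_0_1). intros v _.
    apply (ex_RInt_continuous (V := R_CompleteNormedModule)); intros s _.
    apply Ccontinuous_Re, Hf.
- rewrite (RInt_ext _ (fun s => Derive (fun v => Im (f v s)) u))
    by (intros; symmetry; apply is_derive_unique, DI).
  apply is_derive_RInt_param.
  + exists (mkposreal 1 Rlt_0_1). intros v _ s _. eexists; apply DI.
  + intros s _. apply continuity_2d_pt_ext with (fun v s => Im (df v s)).
    { intros; symmetry; apply is_derive_unique, DI. }
    apply continuity_2d_pt_filterlim, (Ccontinuous_Im _ _ (Hc u s)).
  + exists (mkposreal 1 Rlt_0_1). intros v _.
    apply (ex_RInt_continuous (V := R_CompleteNormedModule)); intros s _.
    apply Ccontinuous_Im, Hf.
Qed.

(** The types of values of derivatives and integrals are carriers of normed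
modules; the change exposes them as C, which ring and field require. *)
Ltac Cring :=
  match goal with |- ?a = ?b => change (@eq C a b) end; cbv beta; ring.

Ltac Cfield :=
  match goal with |- ?a = ?b => change (@eq C a b) end; cbv beta; field.

Lemma is_Cderive_sqr (f : R -> C) x df :
  is_Cderive f x df -> is_Cderive (fun u => f u ^ 2)%C x (2 * f x * df)%C.
Proof.
intros H. apply (is_derive_ext (V := C_R_NormedModule) (fun u => f u * f u)%C).
- intros u. change ((f u * f u)%C = (f u ^ 2)%C). ring.
- eapply is_Cderive_val; [apply is_Cderive_mult; exact H|Cring].
Qed.

Lemma Ccontinuous_sqr {U : UniformSpace} (f : U -> C) x :
  Ccontinuous f x -> Ccontinuous (fun u => f u ^ 2)%C x.
Proof.
intros H. apply (continuous_ext (fun u => f u * f u)%C).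
- intros u. change ((f u * f u)%C = (f u ^ 2)%C). ring.
- apply Ccontinuous_mult; exact H.
Qed.

Lemma Ccontinuous_minus {U : UniformSpace} (f g : U -> C) x :
  Ccontinuous f x -> Ccontinuous g x -> Ccontinuous (fun u => f u - g u)%C x.
Proof. exact (continuous_minus (V := C_R_NormedModule) f g x). Qed.

(** Syntactic matching, since unification up to conversion would unfold the
complex operations into pairs of real ones. *)
Ltac Cderive :=
  lazymatch goal with
  | |- is_derive (fun _ => ?c) _ _ => apply is_Cderive_const
  | |- is_derive (fun u => RtoC u) _ _ => apply is_Cderive_id
  | |- is_derive RtoC _ _ => apply is_Cderive_id
  | |- is_derive (fun u => Cexp _) _ _ => apply is_Cderive_Cexp; Cderive
  | |- is_derive (fun u => Cpow _ 2) _ _ => apply is_Cderive_sqr; Cderive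
  | |- is_derive (fun u => Cmult _ _) _ _ => apply is_Cderive_mult; Cderive
  | |- is_derive (fun u => Cminus _ _) _ _ => apply is_Cderive_minus; Cderive
  | |- is_derive (fun u => Cplus _ _) _ _ => apply is_Cderive_plus; Cderive
  | |- is_derive (fun u => Copp _) _ _ => apply is_Cderive_opp; Cderive
  | |- _ => idtac
  end.

Ltac Ccont :=
  lazymatch goal with
  | |- continuous (fun _ => ?c) _ => apply continuous_const
  | |- continuous RtoC _ => apply (Ccontinuous_RtoC (fun u => u)), continuous_id
  | |- continuous (fun u => Cexp _) _ => apply Ccontinuous_Cexp; Ccont
  | |- continuous (fun u => Cpow _ 2) _ => apply Ccontinuous_sqr; Ccont
  | |- continuous (fun u => Cmult _ _) _ => apply Ccontinuous_mult; Ccont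
  | |- continuous (fun u => Cminus _ _) _ => apply Ccontinuous_minus; Ccont
  | |- continuous (fun u => Cplus _ _) _ => apply Ccontinuous_plus; Ccont
  | |- continuous (fun u => Copp _) _ => apply Ccontinuous_opp; Ccont
  | |- continuous (fun u => RtoC _) _ => apply Ccontinuous_RtoC; Ccont
  | |- continuous (fun u => u) _ => apply continuous_id
  | |- continuous fst _ => apply continuous_fst
  | |- continuous snd _ => apply continuous_snd
  | |- _ => idtac
  end.

Lemma exp_le_compat (a b : R) : a <= b -> exp a <= exp b.
Proof. intros [H| ->]; [apply Rlt_le, exp_increasing, H|apply Rle_refl]. Qed.

Lemma Cexp_plus (z w : C) : Cexp (z + w) = (Cexp z * Cexp w)%C.
Proof.
destruct z as [a b], w as [c d]. unfold Cexp, Cmult, Cplus, Re, Im; cbn [fst snd].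
rewrite exp_plus, cos_plus, sin_plus. f_equal; ring.
Qed.

Lemma Cexp_0 : Cexp 0 = 1.
Proof. unfold Cexp, RtoC, Re, Im; cbn [fst snd]. rewrite exp_0, cos_0, sin_0. f_equal; ring. Qed.

Lemma Cmod_Cexp (z : C) : Cmod (Cexp z) = exp (Re z).
Proof.
unfold Cmod, Cexp; cbn [fst snd].
replace (_ + _) with (exp (Re z) ^ 2 * (Rsqr (sin (Im z)) + Rsqr (cos (Im z))))
  by (unfold Rsqr; ring).
rewrite sin2_cos2, Rmult_1_r. apply sqrt_pow2, Rlt_le, exp_pos.
Qed.

Lemma is_RInt_Cderive (f df : R -> C) (a b : R) :
  (forall x, is_Cderive f x (df x)) -> (forall x, Ccontinuous df x) ->
  is_RInt (V := C_R_NormedModule) df a b (f b - f a)%C.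
Proof.
intros Hd Hc.
apply (is_RInt_derive (V := C_R_CompleteNormedModule)); intros x _; [apply Hd|apply Hc].
Qed.

Lemma RInt_Cderive (f df : R -> C) (a b : R) :
  (forall x, is_Cderive f x (df x)) -> (forall x, Ccontinuous df x) ->
  RInt (V := C_R_CompleteNormedModule) df a b = (f b - f a)%C.
Proof. intros Hd Hc. apply is_RInt_unique, is_RInt_Cderive; assumption. Qed.

(** Mean value inequality, as a comparison of the integrals of the derivatives. *)
Lemma Cderive_increment_le (f df : R -> C) (g dg : R -> R) (a b : R) :
  a <= b ->
  (forall x, is_Cderive f x (df x)) -> (forall x, Ccontinuous df x) ->
  (forall x, is_derive g x (dg x)) -> (forall x, continuous dg x) ->
  (forall x, a <= x <= b -> Cmod (df x) <= dg x) ->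
  Cmod (f b - f a) <= g b - g a.
Proof.
intros Hab Hf Hcf Hg Hcg Hle.
rewrite Cmod_norm.
apply (norm_RInt_le (V := C_R_NormedModule) df dg a b).
- exact Hab.
- intros x Hx. rewrite <- Cmod_norm. now apply Hle.
- now apply is_RInt_Cderive.
- apply (is_RInt_derive (V := R_CompleteNormedModule)); intros x _; [apply Hg|apply Hcg].
Qed.

Lemma Cexp_RtoC (r : R) : Cexp r = RtoC (exp r).
Proof.
unfold Cexp, RtoC, Re, Im; cbn [fst snd]. rewrite cos_0, sin_0. f_equal; ring.
Qed.

Lemma Cmod_Cexp_imaginary (r : R) : Cmod (Cexp (Ci * r)) = 1.
Proof. rewrite Cmod_Cexp. replace (Re _) with 0 by (cbn; ring). apply exp_0. Qed.

Lemma RtoC_neq_0 (r : R) : r <> 0 -> RtoC r <> 0.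
Proof. intros H E. apply H, RtoC_inj, E. Qed.

Lemma Ci_neq_0 : Ci <> 0.
Proof. intros E. apply (f_equal Im) in E. cbn in E. lra. Qed.

Lemma Ci_sqr : (Ci * Ci = -1)%C.
Proof. unfold Ci, Cmult, RtoC; cbn [fst snd]. f_equal; ring. Qed.

(** * The complex error function *)

Definition Cerf' (z : C) : C := (2 / sqrt PI * Cexp (- z ^ 2))%C.

(** Path independence for erf, in the form of its derivative along an
arbitrary line. Differentiating the integrand of erf (z) in direction q gives
the derivative in s of q s exp (- (s z)^2), so the integral telescopes. *)
Lemma is_Cderive_Cerf (p q : C) (u : R) :
  is_Cderive (fun v => Cerf (p + v * q)) u (q * Cerf' (p + u * q))%C.
Proof.
pose (f := fun v s : R => (Cexp (- (s * (p + v * q)) ^ 2) * (p + v * q))%C).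
pose (df := fun v s : R =>
  (q * (1 - 2 * s ^ 2 * (p + v * q) ^ 2) * Cexp (- (s * (p + v * q)) ^ 2))%C).
assert (Hint : RInt (V := C_R_CompleteNormedModule) (df u) 0 1
  = (q * Cexp (- (p + u * q) ^ 2))%C).
{ rewrite (RInt_Cderive (fun s => q * s * Cexp (- (s * (p + u * q)) ^ 2))%C).
  - replace (1 * (p + u * q))%C with (p + u * q)%C by ring. Cring.
  - intros s. unfold df. eapply is_Cderive_val; [Cderive|]. Cring.
  - intros s. unfold df. Ccont. }
unfold Cerf'. replace (q * (2 / sqrt PI * Cexp (- (p + u * q) ^ 2)))%C
  with (2 / sqrt PI * (q * Cexp (- (p + u * q) ^ 2)))%C by ring.
rewrite <- Hint. unfold Cerf.
eapply is_Cderive_val.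
- apply is_Cderive_mult; [apply is_Cderive_const|].
  apply (Cderive_RInt_param f df).
  + intros v s. unfold f, df. eapply is_Cderive_val; [Cderive|]. Cring.
  + intros v s. unfold df. Ccont.
  + intros v s. unfold f. Ccont.
- Cring.
Qed.

Lemma Cerf_0 : Cerf 0 = 0.
Proof.
unfold Cerf.
rewrite (RInt_Cderive (fun _ => 0)).
- Cring.
- intros s. eapply is_Cderive_val; [apply is_Cderive_const|Cring].
- intros s. Ccont.
Qed.

Lemma Cerf_opp (z : C) : Cerf (- z) = (- Cerf z)%C.
Proof.
unfold Cerf.
rewrite (RInt_ext (V := C_R_CompleteNormedModule) _
  (fun s => opp (Cexp (- (s * z) ^ 2) * z : C_R_CompleteNormedModule)%C)).
- rewrite RInt_opp.
  + unfold opp; simpl. change prod_opp with Copp. ring.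
  + apply (ex_RInt_continuous (V := C_R_CompleteNormedModule)). intros s _. Ccont.
- intros s _. change ((Cexp (- (s * - z) ^ 2) * - z)%C = (- (Cexp (- (s * z) ^ 2) * z))%C).
  replace ((s * - z) ^ 2)%C with ((s * z) ^ 2)%C by ring. ring.
Qed.

Lemma sqrt_PI_bounds : 1 < sqrt PI /\ sqrt PI * sqrt PI = PI.
Proof.
pose proof PI2_1. split.
- rewrite <- sqrt_1. apply sqrt_lt_1; lra.
- apply sqrt_sqrt; lra.
Qed.

Lemma Cmod_Cerf' (z : C) : Cmod (Cerf' z) <= 2 * exp (Re (- z ^ 2)).
Proof.
destruct sqrt_PI_bounds as [H1 _].
unfold Cerf'. rewrite Cmod_mult, Cmod_Cexp.
apply Rmult_le_compat_r; [apply Rlt_le, exp_pos|].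
rewrite <- RtoC_div, Cmod_R, Rabs_pos_eq by (try apply Rlt_le, Rdiv_lt_0_compat; lra).
apply Rle_div_l; lra.
Qed.

Lemma Re_Cerf_nonneg (u : R) : 0 <= u -> 0 <= Re (Cerf u).
Proof.
intros Hu. destruct sqrt_PI_bounds as [H1 _].
assert (Hd : forall v, is_derive (fun v : R => Re (Cerf (0 + v * 1))) v
   (Re (1 * Cerf' (0 + v * 1)))).
{ intros v. apply (is_Cderive_Re _ _ _ (is_Cderive_Cerf 0 1 v)). }
destruct (MVT_gen (fun v : R => Re (Cerf (0 + v * 1))) 0 u _
  (fun v _ => Hd v)) as (c & _ & E).
{ intros v _. apply continuity_pt_filterlim.
  apply (ex_derive_continuous (V := R_NormedModule)). eexists; apply Hd. }
revert E. replace (0 + u * 1)%C with (RtoC u) by ring.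
replace (0 + 0 * 1)%C with (RtoC 0) by ring.
replace (1 * Cerf' (0 + c * 1))%C with (RtoC (2 / sqrt PI * exp (- c ^ 2))).
- rewrite Cerf_0. cbn [Re RtoC fst]. intros E.
  assert (0 < 2 / sqrt PI * exp (- c ^ 2)).
  { apply Rmult_lt_0_compat; [apply Rdiv_lt_0_compat; lra|apply exp_pos]. }
  nra.
- unfold Cerf'. replace (- (0 + c * 1) ^ 2)%C with (RtoC (- c ^ 2)).
  + rewrite Cexp_RtoC, RtoC_mult, RtoC_div by lra. ring.
  + rewrite RtoC_opp, RtoC_pow. ring.
Qed.

(** The Gaussian integral without double integrals. The derivative in u of the
integral is - 2 u exp (- u^2) times the integral of exp (- (u s)^2), which is a
multiple of exp (- u^2) erf (u) and cancels the derivative of erf (u)^2. The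
constant is the value at u = 0, where the integral is atan 1. *)
Lemma Cerf_sqr_plus_RInt (u : R) :
  (Cerf u ^ 2 + 4 / PI * RInt (V := C_R_CompleteNormedModule)
    (fun s : R => Cexp (- (u ^ 2 * (1 + s ^ 2))) * RtoC (/ (1 + s ^ 2)%R)) 0 1)%C
  = RtoC 1.
Proof.
destruct sqrt_PI_bounds as [H1 H2]. pose proof PI_RGT_0 as HPI.
assert (Hpos : forall s, 0 < 1 + s ^ 2) by (intros s; nra).
pose (f := fun v s : R => (Cexp (- (v ^ 2 * (1 + s ^ 2))) * RtoC (/ (1 + s ^ 2)%R))%C).
pose (df := fun v s : R => (- (2 * v) * Cexp (- (v ^ 2 * (1 + s ^ 2))))%C).
pose (D := fun v : R => (Cerf (0 + v * 1) ^ 2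
  + 4 / PI * RInt (V := C_R_CompleteNormedModule) (f v) 0 1)%C).
assert (Hinv : forall s : R, continuous (fun s => / (1 + s ^ 2)) s).
{ intros s. apply (ex_derive_continuous (V := R_NormedModule)). auto_derive.
  specialize (Hpos s). simpl in Hpos. lra. }
assert (Hint : forall v : R, RInt (V := C_R_CompleteNormedModule) (df v) 0 1
  = (- sqrt PI * Cexp (- v ^ 2) * Cerf v)%C :> C).
{ intros v. rewrite (RInt_Cderive (fun s => - sqrt PI * Cexp (- v ^ 2) * Cerf (0 + s * v))%C).
  - replace (0 + 1 * v)%C with (RtoC v) by ring.
    replace (0 + 0 * v)%C with (RtoC 0) by ring. rewrite Cerf_0. Cring.
  - intros s. unfold df. eapply is_Cderive_val.
    + apply is_Cderive_mult; [Cderive|apply is_Cderive_Cerf].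
    + unfold Cerf'. replace (- (v ^ 2 * (1 + s ^ 2)))%C
        with (- v ^ 2 + - (0 + s * v) ^ 2)%C by ring.
      rewrite Cexp_plus.
      Cfield.
      intros E. apply RtoC_inj in E. lra.
  - intros s. unfold df. Ccont. }
assert (HD : forall v, is_Cderive D v (RtoC 0)).
{ intros v. unfold D. eapply is_Cderive_val.
  - apply is_Cderive_plus.
    + apply is_Cderive_sqr, is_Cderive_Cerf.
    + apply is_Cderive_mult; [apply is_Cderive_const|].
      apply (Cderive_RInt_param f df).
      * intros w s. unfold f, df. eapply is_Cderive_val; [Cderive|].
        rewrite RtoC_inv by (specialize (Hpos s); lra).
        rewrite RtoC_plus, RtoC_pow.
        Cfield.
        rewrite <- RtoC_pow, <- RtoC_plus. intros E. apply RtoC_inj in E.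
        specialize (Hpos s). lra.
      * intros w s. unfold df. Ccont.
      * intros w s. unfold f. Ccont. apply Hinv.
  - rewrite Hint. unfold Cerf'. replace (0 + v * 1)%C with (RtoC v) by ring.
    set (sp := sqrt PI) in *. rewrite <- H2, RtoC_mult.
    Cfield.
    intros E. apply RtoC_inj in E. lra. }
assert (HD0 : D 0 = RtoC 1).
{ unfold D. replace (0 + 0 * 1)%C with (RtoC 0) by ring. rewrite Cerf_0.
  rewrite (RInt_ext (V := C_R_CompleteNormedModule) _ (fun s => RtoC (/ (1 + s ^ 2)))).
  - rewrite (RInt_Cderive (fun s => RtoC (atan s))).
    + rewrite atan_1, atan_0, RtoC_div by lra.
      Cfield.
      intros E; apply RtoC_inj in E; lra.
    + intros s. apply is_Cderive_RtoC.
      replace (/ (1 + s ^ 2)) with (/ (1 + s²)) by (unfold Rsqr; f_equal; ring).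
      apply is_derive_atan.
    + intros s. apply Ccontinuous_RtoC, Hinv.
  - intros s _. unfold f. replace (- (0 ^ 2 * (1 + s ^ 2)))%C with (RtoC 0) by ring.
    rewrite Cexp_0. Cring. }
transitivity (D u).
{ unfold D, f. now replace (0 + u * 1)%C with (RtoC u) by ring. }
rewrite <- HD0.
destruct (Rtotal_order 0 u) as [H|[<-|H]]; [symmetry| reflexivity |];
  apply (eq_is_derive (V := C_R_NormedModule)); auto; intros v _; apply HD.
Qed.

(** Factor 1 - erf (u)^2; the factor 1 + erf (u) has modulus at least 1
because erf is nonnegative on the half line. *)
Lemma Cmod_erfc_real (u : R) : 0 <= u -> Cmod (1 - Cerf u) <= 4 * exp (- u ^ 2).
Proof.
intros Hu. pose proof PI2_1 as HPI. pose proof (Re_Cerf_nonneg u Hu) as Hre.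
pose proof (Cerf_sqr_plus_RInt u) as E.
set (I := RInt _ 0 1) in E.
assert (HI : Cmod I <= exp (- u ^ 2)).
{ rewrite Cmod_norm. replace (exp _) with ((1 - 0) * exp (- u ^ 2)) by ring.
  apply (norm_RInt_le_const (V := C_R_CompleteNormedModule)
    (fun s : R => Cexp (- (u ^ 2 * (1 + s ^ 2))) * RtoC (/ (1 + s ^ 2)%R))%C); [lra| |].
  - intros s _. rewrite <- Cmod_norm, Cmod_mult, Cmod_Cexp, Cmod_R.
    replace (- (u ^ 2 * (1 + s ^ 2)))%C with (RtoC (- (u ^ 2 * (1 + s ^ 2)))).
    2:{ rewrite RtoC_opp, RtoC_mult, RtoC_plus, !RtoC_pow. reflexivity. }
    cbn [Re RtoC fst].
    rewrite Rabs_pos_eq by (apply Rlt_le, Rinv_0_lt_compat; nra).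
    apply Rle_trans with (exp (- u ^ 2) * 1); [|lra].
    apply Rmult_le_compat.
    + apply Rlt_le, exp_pos.
    + apply Rlt_le, Rinv_0_lt_compat; nra.
    + apply exp_le_compat; nra.
    + rewrite <- Rinv_1. apply Rinv_le_contravar; nra.
  - apply (RInt_correct (V := C_R_CompleteNormedModule)),
      (ex_RInt_continuous (V := C_R_CompleteNormedModule)).
    intros s _. Ccont. apply (ex_derive_continuous (V := R_NormedModule)). auto_derive. nra. }
assert (Hprod : ((1 - Cerf u) * (1 + Cerf u))%C = (4 / PI * I)%C).
{ replace ((1 - Cerf u) * (1 + Cerf u))%C with (1 - Cerf u ^ 2)%C by ring.
  rewrite <- E. ring. }
apply (f_equal Cmod) in Hprod. rewrite !Cmod_mult in Hprod.
assert (H1 : 1 <= Cmod (1 + Cerf u)).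
{ apply Rle_trans with (Re (1 + Cerf u)).
  - change (Re (1 + Cerf u)) with (1 + Re (Cerf u)). lra.
  - apply Rle_trans with (1 := Rle_abs _), re_le_Cmod. }
assert (H4 : Cmod (4 / PI) <= 4).
{ rewrite <- RtoC_div, Cmod_R, Rabs_pos_eq by (try apply Rlt_le, Rdiv_lt_0_compat; lra).
  apply Rle_div_l; lra. }
pose proof (Cmod_ge_0 (1 - Cerf u)). pose proof (Cmod_ge_0 I).
pose proof (Cmod_ge_0 (4 / PI)).
apply Rle_trans with (Cmod (1 - Cerf u) * Cmod (1 + Cerf u)); [nra|].
rewrite Hprod. apply Rmult_le_compat; lra.
Qed.

(** * Decay of Lambda in the right half plane *)

(** Compare erf at z + r with its value at the projection to the real axis: the
vertical segment between them contributes, up to a constant, at most its length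
times the maximum of the modulus of exp (- xi^2). *)
Lemma Cmod_erfc_shift (z : C) (r : R) : 0 <= Re z -> 0 <= r ->
  Cmod (1 - Cerf (z + r)) <= (4 + 2 * Rabs (Im z) * exp (Im z ^ 2)) * exp (- r ^ 2).
Proof.
intros Hx Hr. destruct z as [x y]. cbn [Re Im fst snd] in *.
set (u := x + r).
assert (Ez : ((x, y) + r)%C = (RtoC u + 1 * (RtoC y * Ci))%C).
{ unfold u, Cplus, Cmult, RtoC, Ci; cbn [fst snd]. f_equal; ring. }
assert (E0 : RtoC u = (RtoC u + 0 * (RtoC y * Ci))%C) by ring.
assert (Hv : Cmod (Cerf ((x, y) + r) - Cerf u) <= 2 * Rabs y * exp (y ^ 2 - u ^ 2)).
{ rewrite Ez. rewrite E0 at 2.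
  replace (2 * Rabs y * exp (y ^ 2 - u ^ 2)) with
    (1 * (2 * Rabs y * exp (y ^ 2 - u ^ 2)) - 0 * (2 * Rabs y * exp (y ^ 2 - u ^ 2))) by ring.
  apply (Cderive_increment_le
    (fun v => Cerf (RtoC u + v * (RtoC y * Ci)))
    (fun v => RtoC y * Ci * Cerf' (RtoC u + v * (RtoC y * Ci)))%C
    (fun v => v * (2 * Rabs y * exp (y ^ 2 - u ^ 2)))
    (fun _ => 2 * Rabs y * exp (y ^ 2 - u ^ 2))).
  - lra.
  - intros v. apply is_Cderive_Cerf.
  - intros v. unfold Cerf'. Ccont.
  - intros v. auto_derive; [easy|]. simpl; ring.
  - intros v. apply continuous_const.
  - intros v Hv. rewrite !Cmod_mult, Cmod_R.
    assert (HCi : Cmod Ci = 1).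
    { unfold Cmod, Ci; cbn [fst snd]. replace (0 ^ 2 + 1 ^ 2) with 1 by ring. apply sqrt_1. }
    rewrite HCi, Rmult_1_r.
    apply Rle_trans with (Rabs y * (2 * exp (y ^ 2 - u ^ 2))); [|right; ring].
    apply Rmult_le_compat_l; [apply Rabs_pos|].
    eapply Rle_trans; [apply Cmod_Cerf'|].
    apply Rmult_le_compat_l; [lra|]. apply exp_le_compat.
    replace (Re (- (RtoC u + v * (RtoC y * Ci)) ^ 2)) with (v ^ 2 * y ^ 2 - u ^ 2)
      by (cbn; ring).
    assert (v ^ 2 <= 1) by nra. assert (0 <= y ^ 2) by nra. nra. }
replace (1 - Cerf ((x, y) + r))%C
  with ((1 - Cerf u) + - (Cerf ((x, y) + r) - Cerf u))%C by ring.
eapply Rle_trans; [apply Cmod_triangle|]. rewrite Cmod_opp.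
assert (Hu : 0 <= u) by (unfold u; lra).
pose proof (Cmod_erfc_real u Hu) as H1.
assert (H2 : exp (- u ^ 2) <= exp (- r ^ 2)) by (apply exp_le_compat; unfold u; nra).
assert (H3 : exp (y ^ 2 - u ^ 2) <= exp (y ^ 2) * exp (- r ^ 2)).
{ rewrite <- exp_plus. apply exp_le_compat; unfold u; nra. }
pose proof (Rabs_pos y).
assert (2 * Rabs y * exp (y ^ 2 - u ^ 2) <= 2 * Rabs y * (exp (y ^ 2) * exp (- r ^ 2))).
{ apply Rmult_le_compat_l; lra. }
lra.
Qed.

(** For r > 0, exp (z^2) (erf (z + r) - erf z) is 2 / sqrt pi <= 2 times the
integral of exp (z^2 - (z + v)^2) over 0 <= v <= r, whose integrand has modulus at
most exp (- 2 v Re z); this gives the bound 1 / Re z. The remainder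
exp (z^2) (1 - erf (z + r)) tends to 0 as r grows. *)
Lemma Cmod_Lambda_le (z : C) : 0 < Re z -> Cmod (Lambda z) <= / Re z.
Proof.
intros Hx. set (x := Re z) in *.
set (K := exp (Re (z ^ 2)) * (4 + 2 * Rabs (Im z) * exp (Im z ^ 2))).
assert (HK : 0 <= K).
{ pose proof (Rabs_pos (Im z)). pose proof (exp_pos (Im z ^ 2)).
  pose proof (exp_pos (Re (z ^ 2))). unfold K. apply Rmult_le_pos; [lra|]. nra. }
assert (Hr : forall r, 0 < r -> Cmod (Lambda z) <= / x + K / r).
{ intros r Hr.
  assert (H1 : Cmod (Cexp (z ^ 2) * Cerf (z + r * 1) - Cexp (z ^ 2) * Cerf (z + 0 * 1))
     <= - exp (- 2 * x * r) / x - - exp (- 2 * x * 0) / x).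
  { apply (Cderive_increment_le
      (fun v => Cexp (z ^ 2) * Cerf (z + v * 1))%C
      (fun v => Cexp (z ^ 2) * (1 * Cerf' (z + v * 1)))%C
      (fun v => - exp (- 2 * x * v) / x) (fun v => 2 * exp (- 2 * x * v))).
    - lra.
    - intros v. eapply is_Cderive_val.
      + apply is_Cderive_mult; [apply is_Cderive_const|apply is_Cderive_Cerf].
      + Cring.
    - intros v. unfold Cerf'. Ccont.
    - intros v. auto_derive; [easy|field; lra].
    - intros v. apply (ex_derive_continuous (V := R_NormedModule)). auto_derive; easy.
    - intros v Hv. rewrite !Cmod_mult, Cmod_1, Rmult_1_l, Cmod_Cexp.
      apply Rle_trans with (exp (Re (z ^ 2)) * (2 * exp (Re (- (z + v * 1) ^ 2)))).
      { apply Rmult_le_compat_l; [apply Rlt_le, exp_pos|apply Cmod_Cerf']. }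
      replace (exp (Re (z ^ 2)) * (2 * exp (Re (- (z + v * 1) ^ 2))))
        with (2 * exp (Re (z ^ 2) + Re (- (z + v * 1) ^ 2))) by (rewrite exp_plus; ring).
      apply Rmult_le_compat_l; [lra|]. apply exp_le_compat.
      replace (Re (z ^ 2) + Re (- (z + v * 1) ^ 2)) with (- 2 * x * v - v ^ 2)
        by (unfold x; destruct z; cbn; ring).
      nra. }
  replace (z + r * 1)%C with (z + r)%C in H1 by ring.
  replace (z + 0 * 1)%C with z in H1 by ring.
  replace (- 2 * x * 0) with 0 in H1 by ring. rewrite exp_0 in H1.
  pose proof (Cmod_erfc_shift z r (Rlt_le _ _ Hx) (Rlt_le _ _ Hr)) as H2.
  unfold Lambda.
  replace (Cexp (z ^ 2) * (1 - Cerf z))%C with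
    (Cexp (z ^ 2) * (1 - Cerf (z + r))
     + (Cexp (z ^ 2) * Cerf (z + r) - Cexp (z ^ 2) * Cerf z))%C by ring.
  eapply Rle_trans; [apply Cmod_triangle|].
  rewrite Cmod_mult, Cmod_Cexp.
  assert (H3 : exp (- r ^ 2) <= / r).
  { rewrite exp_Ropp. apply Rinv_le_contravar; [exact Hr|].
    apply Rle_trans with (1 + r ^ 2); [nra|]. apply exp_ineq1_le. }
  assert (H4 : exp (Re (z ^ 2)) * Cmod (1 - Cerf (z + r)) <= K * / r).
  { unfold K. rewrite Rmult_assoc. apply Rmult_le_compat_l; [apply Rlt_le, exp_pos|].
    eapply Rle_trans; [apply H2|]. apply Rmult_le_compat_l; [|exact H3].
    pose proof (Rabs_pos (Im z)). pose proof (exp_pos (Im z ^ 2)). nra. }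
  assert (0 < exp (- 2 * x * r) / x) by (apply Rdiv_lt_0_compat; [apply exp_pos|exact Hx]).
  unfold Rdiv in *. lra. }
(* Letting r tend to infinity in Hr. *)
apply Rnot_lt_le. intros Hlt.
set (d := Cmod (Lambda z) - / x).
assert (Hd : 0 < d) by (unfold d; lra).
assert (Hp : 0 < (K + 1) / d) by (apply Rdiv_lt_0_compat; lra).
specialize (Hr _ Hp).
assert (K / ((K + 1) / d) < d).
{ replace (K / ((K + 1) / d)) with (d * (K / (K + 1))) by (field; lra).
  rewrite <- (Rmult_1_r d) at 2. apply Rmult_lt_compat_l; [exact Hd|].
  apply Rlt_div_l; lra. }
unfold d in *. lra.
Qed.

(** * Exponentially modulated error functions *)

Lemma sqrt_it_pair (t : R) : sqrt_it t = (sqrt (t / 2), sqrt (t / 2)).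
Proof.
unfold sqrt_it.
assert (E : Cexp (Ci * (PI / 4)) = (/ sqrt 2, / sqrt 2)).
{ unfold Cexp. rewrite <- RtoC_div by lra.
  replace (Re (Ci * RtoC (PI / 4))) with 0 by (cbn; ring).
  replace (Im (Ci * RtoC (PI / 4))) with (PI / 4) by (cbn; ring).
  rewrite exp_0, cos_PI4, sin_PI4. f_equal; lra. }
rewrite E. unfold Cmult, RtoC; cbn [fst snd].
destruct (Rle_dec 0 t) as [Ht|Ht].
- rewrite sqrt_div by lra. f_equal; field; apply Rgt_not_eq, sqrt_lt_R0; lra.
- rewrite (sqrt_neg_0 t), (sqrt_neg_0 (t / 2)) by lra. f_equal; ring.
Qed.

Lemma sqrt_it_neq_0 (t : R) : 0 < t -> sqrt_it t <> 0.
Proof.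
intros Ht E. rewrite sqrt_it_pair in E. apply (f_equal Re) in E. cbn in E.
assert (0 < sqrt (t / 2)) by (apply sqrt_lt_R0; lra). lra.
Qed.

Lemma sqrt_it_sqr (t : R) : 0 < t -> (sqrt_it t ^ 2 = Ci * t)%C.
Proof.
intros Ht. rewrite sqrt_it_pair.
assert (E : sqrt (t / 2) * sqrt (t / 2) = t / 2) by (apply sqrt_sqrt; lra).
cbn. unfold Cmult, RtoC, Ci; cbn [fst snd]. f_equal; [ring|]. nra.
Qed.

Lemma sqrt_ipit_eq (t : R) : 0 < t -> sqrt_ipit t = (sqrt_it t * sqrt PI)%C.
Proof.
intros Ht. pose proof PI_RGT_0. unfold sqrt_ipit, sqrt_it.
rewrite sqrt_mult, RtoC_mult by lra. ring.
Qed.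

Definition chirp (t a : R) : C := Cexp (- (a ^ 2 / (4 * Ci * t))).

Definition wave_arg (t : R) (kappa : C) (a : R) : C :=
  (a / (2 * sqrt_it t) + kappa * sqrt_it t)%C.

(** A solution of the free Schroedinger equation whose value at t = 0^+ is
2 exp (kappa a) for a < 0 and 0 for a > 0. *)
Definition wave (t : R) (kappa : C) (a : R) : C :=
  (Cexp (kappa * a + Ci * kappa ^ 2 * t) * (1 - Cerf (wave_arg t kappa a)))%C.

Lemma wave_arg_sqr (t : R) (kappa : C) (a : R) : 0 < t ->
  (wave_arg t kappa a ^ 2 = a ^ 2 / (4 * Ci * t) + (kappa * a + Ci * kappa ^ 2 * t))%C.
Proof.
intros Ht. unfold wave_arg.
transitivity (a ^ 2 / (4 * sqrt_it t ^ 2) + (kappa * a + kappa ^ 2 * sqrt_it t ^ 2))%C.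
- field. now apply sqrt_it_neq_0.
- rewrite sqrt_it_sqr by exact Ht. field. split; [apply RtoC_neq_0; lra|apply Ci_neq_0].
Qed.

(** The relation of the waves to the Green's function, and the form in which
the bound on Lambda applies to them. *)
Lemma wave_Lambda (t : R) (kappa : C) (a : R) : 0 < t ->
  wave t kappa a = (Lambda (wave_arg t kappa a) * chirp t a)%C.
Proof.
intros Ht. unfold Lambda, wave, chirp. rewrite wave_arg_sqr, (Cexp_plus (_ / _)) by exact Ht.
set (A := (a ^ 2 / (4 * Ci * t))%C).
replace (Cexp A * Cexp (kappa * a + Ci * kappa ^ 2 * t) *
  (1 - Cerf (wave_arg t kappa a)) * Cexp (- A))%C with
 (Cexp A * Cexp (- A) * Cexp (kappa * a + Ci * kappa ^ 2 * t) *
  (1 - Cerf (wave_arg t kappa a)))%C by ring.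
rewrite <- (Cexp_plus A). replace (A + - A)%C with (RtoC 0) by ring.
rewrite Cexp_0. ring.
Qed.

Lemma Cmod_chirp (t a : R) : 0 < t -> Cmod (chirp t a) = 1.
Proof.
intros Ht. unfold chirp. rewrite Cmod_Cexp.
replace (- (a ^ 2 / (4 * Ci * t)))%C with (RtoC (a ^ 2 / (4 * t)) * Ci)%C.
- replace (Re _) with 0 by (cbn; ring). apply exp_0.
- rewrite RtoC_div, RtoC_mult, RtoC_pow by lra.
  transitivity (- (a ^ 2 / (4 * Ci * t)) * (- (Ci * Ci)))%C.
  + field. split; [apply RtoC_neq_0; lra|apply Ci_neq_0].
  + rewrite Ci_sqr. ring.
Qed.

(** The sign of Re kappa - Im kappa decides whether the argument moves into the
right or the left half plane as t grows. *)
Lemma Re_wave_arg (t : R) (kappa : C) (a : R) : 0 < t ->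
  Re (wave_arg t kappa a)
  = a / (4 * sqrt (t / 2)) + (Re kappa - Im kappa) * sqrt (t / 2).
Proof.
intros Ht. unfold wave_arg. rewrite sqrt_it_pair.
assert (Hr : 0 < sqrt (t / 2)) by (apply sqrt_lt_R0; lra).
set (r := sqrt (t / 2)) in *. destruct kappa as [k1 k2]. cbn. field. nra.
Qed.

Lemma Cmod_wave_le (t : R) (kappa : C) (a : R) : 0 < t ->
  0 < a / (4 * sqrt (t / 2)) + (Re kappa - Im kappa) * sqrt (t / 2) ->
  Cmod (wave t kappa a)
  <= / (a / (4 * sqrt (t / 2)) + (Re kappa - Im kappa) * sqrt (t / 2)).
Proof.
intros Ht Hp. rewrite wave_Lambda, Cmod_mult, Cmod_chirp, Rmult_1_r by exact Ht.
rewrite <- Re_wave_arg in * by exact Ht. now apply Cmod_Lambda_le.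
Qed.

(** Oddness of erf. *)
Lemma wave_reflect (t : R) (kappa : C) (a : R) :
  (wave t kappa a + wave t (- kappa) (- a))%C
  = (2 * Cexp (kappa * a + Ci * kappa ^ 2 * t))%C.
Proof.
unfold wave.
replace (wave_arg t (- kappa) (- a)) with (- wave_arg t kappa a)%C
  by (unfold wave_arg; rewrite RtoC_opp; unfold Cdiv; ring).
rewrite Cerf_opp, RtoC_opp.
replace (- kappa * - a + Ci * (- kappa) ^ 2 * t)%C
  with (kappa * a + Ci * kappa ^ 2 * t)%C by ring.
ring.
Qed.

(** The product rule: the term from erf collapses to the chirp, since the
square of the argument contains the whole exponent of the prefactor. *)
Lemma is_Cderive_wave (t : R) (kappa : C) (c y : R) : 0 < t ->
  is_Cderive (fun y => wave t kappa (c + y)) y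
    (kappa * wave t kappa (c + y) - chirp t (c + y) / sqrt_ipit t)%C.
Proof.
intros Ht. pose proof (sqrt_it_neq_0 t Ht) as Hs.
destruct sqrt_PI_bounds as [HPI _].
set (p := (c / (2 * sqrt_it t) + kappa * sqrt_it t)%C).
set (q := (1 / (2 * sqrt_it t))%C).
assert (Ez : forall y : R, wave_arg t kappa (c + y) = (p + y * q)%C).
{ intros v. unfold wave_arg, p, q. rewrite RtoC_plus. field. exact Hs. }
apply (is_derive_ext (V := C_R_NormedModule)
  (fun y => Cexp (kappa * c + kappa * y + Ci * kappa ^ 2 * t) * (1 - Cerf (p + y * q)))%C).
{ intros v. unfold wave. rewrite Ez, RtoC_plus. f_equal. f_equal. Cring. }
eapply is_Cderive_val.
- apply is_Cderive_mult; [Cderive|].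
  apply is_Cderive_minus; [apply is_Cderive_const|apply is_Cderive_Cerf].
- assert (Ee : (Cexp (kappa * c + kappa * y + Ci * kappa ^ 2 * t) * Cerf' (p + y * q))%C
    = (2 / sqrt PI * chirp t (c + y))%C).
  { unfold Cerf', chirp. rewrite <- Ez, wave_arg_sqr by exact Ht. rewrite RtoC_plus.
    replace (- ((c + y) ^ 2 / (4 * Ci * t)))%C with
      ((kappa * c + kappa * y + Ci * kappa ^ 2 * t) +
       - ((c + y) ^ 2 / (4 * Ci * t) + (kappa * (c + y) + Ci * kappa ^ 2 * t)))%C by ring.
    rewrite (Cexp_plus (kappa * c + kappa * y + Ci * kappa ^ 2 * t)). ring. }
  unfold wave. rewrite Ez, sqrt_ipit_eq by exact Ht. rewrite RtoC_plus.
  replace (kappa * (c + y) + Ci * kappa ^ 2 * t)%C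
    with (kappa * c + kappa * y + Ci * kappa ^ 2 * t)%C by ring.
  set (A := Cexp (kappa * c + kappa * y + Ci * kappa ^ 2 * t)) in *.
  transitivity (kappa * (A * (1 - Cerf (p + y * q))) - q * (A * Cerf' (p + y * q)))%C.
  + Cring.
  + rewrite Ee. unfold q.
    Cfield.
    split; [apply RtoC_neq_0; lra|exact Hs].
Qed.

Lemma Ccontinuous_chirp (t c y : R) :
  Ccontinuous (fun y => chirp t (c + y)) y.
Proof.
unfold chirp, Cdiv. apply (continuous_ext (fun y : R => Cexp (- ((c + y) ^ 2 * / (4 * Ci * t)))%C)).
- intros v. now rewrite RtoC_plus.
- Ccont.
Qed.

Lemma Ccontinuous_wave (t : R) (kappa : C) (c y : R) : 0 < t ->
  Ccontinuous (fun y => wave t kappa (c + y)) y.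
Proof. intros Ht. eapply is_Cderive_continuous. now apply is_Cderive_wave. Qed.

(** * Asymptotics at rate 1 / sqrt t *)

Lemma O_inv_sqrt_ext (f g : R -> C) :
  (forall t, 0 < t -> f t = g t) -> O_inv_sqrt f -> O_inv_sqrt g.
Proof.
intros E [M [N H]]. exists M, (Rmax N 0). intros t Ht.
pose proof (Rmax_l N 0). pose proof (Rmax_r N 0).
rewrite <- E by lra. apply H; lra.
Qed.

Lemma O_inv_sqrt_plus (f g : R -> C) :
  O_inv_sqrt f -> O_inv_sqrt g -> O_inv_sqrt (fun t => f t + g t)%C.
Proof.
intros [M [N H]] [M' [N' H']]. exists (M + M'), (Rmax N N'). intros t Ht.
pose proof (Rmax_l N N'). pose proof (Rmax_r N N').
eapply Rle_trans; [apply Cmod_triangle|].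
specialize (H t ltac:(lra)). specialize (H' t ltac:(lra)). unfold Rdiv in *. lra.
Qed.

Lemma O_inv_sqrt_mult_bounded (f u : R -> C) (K : R) :
  (forall t, Cmod (u t) <= K) -> O_inv_sqrt f -> O_inv_sqrt (fun t => u t * f t)%C.
Proof.
intros HK [M [N H]]. exists (K * M), N. intros t Ht.
rewrite Cmod_mult. replace (K * M / sqrt t) with (K * (M / sqrt t)) by (unfold Rdiv; ring).
apply Rmult_le_compat; auto using Cmod_ge_0.
Qed.

Lemma O_inv_sqrt_scal (c : C) (f : R -> C) :
  O_inv_sqrt f -> O_inv_sqrt (fun t => c * f t)%C.
Proof. apply (O_inv_sqrt_mult_bounded f (fun _ => c) (Cmod c)). intros _; lra. Qed.

(** The form in which the bound on Lambda enters: f is at most the inverse of a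
quantity d growing at least like sqrt t. *)
Lemma O_inv_sqrt_inv (f : R -> C) (d : R -> R) (delta N : R) : 0 < delta ->
  (forall t, N < t -> 0 < t -> delta * sqrt t <= d t) ->
  (forall t, 0 < t -> 0 < d t -> Cmod (f t) <= / d t) -> O_inv_sqrt f.
Proof.
intros Hd Hlow Hf. exists (/ delta), (Rmax N 0). intros t Ht.
pose proof (Rmax_l N 0). pose proof (Rmax_r N 0).
assert (Hs : 0 < sqrt t) by (apply sqrt_lt_R0; lra).
assert (Hl := Hlow t ltac:(lra) ltac:(lra)).
assert (0 < delta * sqrt t) by (apply Rmult_lt_0_compat; lra).
eapply Rle_trans; [apply Hf; lra|].
unfold Rdiv. rewrite <- Rinv_mult. apply Rinv_le_contravar; lra.
Qed.

Lemma O_inv_sqrt_filterlim (f : R -> C) : O_inv_sqrt f ->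
  filterlim (fun t => f t : C_R_NormedModule) (Rbar_locally p_infty)
    (locally (zero : C_R_NormedModule)).
Proof.
intros [M [N H]]. apply (filterlim_norm_zero (V := C_R_NormedModule)).
apply filterlim_locally. intros eps.
exists (Rmax N (Rmax 0 (((Rabs M + 1) / eps) ^ 2))). intros t Ht.
pose proof (Rmax_l N (Rmax 0 (((Rabs M + 1) / eps) ^ 2))).
pose proof (Rmax_r N (Rmax 0 (((Rabs M + 1) / eps) ^ 2))).
pose proof (Rmax_l 0 (((Rabs M + 1) / eps) ^ 2)).
pose proof (Rmax_r 0 (((Rabs M + 1) / eps) ^ 2)).
pose proof (cond_pos eps) as He. pose proof (Rabs_pos M) as HM.
assert (Hq : 0 < (Rabs M + 1) / eps) by (apply Rdiv_lt_0_compat; lra).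
assert (Hs : (Rabs M + 1) / eps < sqrt t).
{ rewrite <- (sqrt_pow2 ((Rabs M + 1) / eps)) by lra. apply sqrt_lt_1; [apply pow2_ge_0|lra|lra]. }
specialize (H t ltac:(lra)).
change (Rabs (minus (norm (f t : C_R_NormedModule)) 0) < eps).
unfold minus, plus, opp; simpl. rewrite <- Cmod_norm, Ropp_0, Rplus_0_r.
rewrite Rabs_pos_eq by apply Cmod_ge_0.
eapply Rle_lt_trans; [apply H|].
apply Rlt_div_l; [lra|]. apply Rlt_div_l in Hs; [|exact He].
pose proof (Rle_abs M). lra.
Qed.

(** Decay in space for fixed t. The true rate is 1 / y; the weaker rate lets
the closure properties above serve for both limits. *)
Lemma O_inv_sqrt_wave_space (t : R) (kappa : C) (c : R) : 0 < t ->
  O_inv_sqrt (fun y => wave t kappa (c + y)).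
Proof.
intros Ht. set (r := sqrt (t / 2)).
assert (Hr : 0 < r) by (apply sqrt_lt_R0; lra).
set (b := c / (4 * r) + (Re kappa - Im kappa) * r).
apply (O_inv_sqrt_inv _ (fun y => y / (4 * r) + b) (/ (8 * r)) (Rmax 1 (- b * (8 * r)))).
- apply Rinv_0_lt_compat; lra.
- intros y Hy Hy0.
  pose proof (Rmax_l 1 (- b * (8 * r))). pose proof (Rmax_r 1 (- b * (8 * r))).
  assert (Hy1 : sqrt y <= y).
  { pose proof (sqrt_sqrt y ltac:(lra)).
    assert (1 <= sqrt y) by (rewrite <- sqrt_1; apply sqrt_le_1; lra). nra. }
  apply Rle_trans with (/ (8 * r) * y).
  { apply Rmult_le_compat_l; [apply Rlt_le, Rinv_0_lt_compat; lra|exact Hy1]. }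
  (* Half of the linear term y / (4 r) absorbs the constant b. *)
  assert (- b <= y / (8 * r)) by (apply Rle_div_r; lra).
  replace (y / (4 * r)) with (2 * (y / (8 * r))) by (field; lra).
  unfold Rdiv in *. lra.
- intros y _ Hpos.
  replace (y / (4 * r) + b) with ((c + y) / (4 * r) + (Re kappa - Im kappa) * r) in *
    by (unfold b; field; lra).
  now apply Cmod_wave_le.
Qed.

Lemma O_inv_sqrt_wave_time (kappa : C) (a : R) : 0 < Re kappa - Im kappa ->
  O_inv_sqrt (fun t => wave t kappa a).
Proof.
intros Hk. set (m := Re kappa - Im kappa) in *.
assert (H2 : 0 < / sqrt 2) by (apply Rinv_0_lt_compat, sqrt_lt_R0; lra).
apply (O_inv_sqrt_inv _ (fun t => a / (4 * sqrt (t / 2)) + m * sqrt (t / 2))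
  (m / 2 * / sqrt 2) (Rabs a / m)).
- apply Rmult_lt_0_compat; lra.
- intros t Ht Ht0.
  assert (Hr : 0 < sqrt (t / 2)) by (apply sqrt_lt_R0; lra).
  replace (m / 2 * / sqrt 2 * sqrt t) with (m / 2 * sqrt (t / 2))
    by (rewrite sqrt_div by lra; unfold Rdiv; ring).
  assert (Hrr := sqrt_sqrt (t / 2) ltac:(lra)).
  set (r := sqrt (t / 2)) in *.
  apply Rlt_div_l in Ht; [|exact Hk].
  assert (- (m / 2 * r) <= a / (4 * r)).
  { apply Rle_div_r; [lra|].
    replace (- (m / 2 * r) * (4 * r)) with (- (2 * m) * (r * r)) by field.
    rewrite Hrr. pose proof (Rle_abs (- a)). rewrite Rabs_Ropp in *. lra. }
  lra.
- intros t Ht Hpos. now apply Cmod_wave_le.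
Qed.

(** Reflection turns the growing argument into one in the right half plane, at
the cost of the explicit exponential. *)
Lemma O_inv_sqrt_wave_residue (kappa : C) (a : R) : Re kappa - Im kappa < 0 ->
  O_inv_sqrt (fun t => wave t kappa a - 2 * Cexp (kappa * a + Ci * kappa ^ 2 * t))%C.
Proof.
intros Hk. apply (O_inv_sqrt_ext (fun t => -1 * wave t (- kappa) (- a))%C).
- intros t _. rewrite <- wave_reflect. ring.
- apply O_inv_sqrt_scal, O_inv_sqrt_wave_time. destruct kappa; cbn in *; lra.
Qed.

(** For kappa = 0 the argument a / (2 s) tends to 0 along the ray of direction
exp (- i pi / 4), on which exp (- xi^2) has modulus 1; hence erf is at most a
multiple of |a / (2 s)|. *)
Lemma O_inv_sqrt_wave_0 (a : R) : O_inv_sqrt (fun t => wave t 0 a - 1)%C.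
Proof.
exists (2 * Rabs a), 0. intros t Ht.
set (r := sqrt (t / 2)).
assert (Hr : 0 < r) by (apply sqrt_lt_R0; lra).
assert (Hs : sqrt t <= 2 * r).
{ unfold r. rewrite <- (sqrt_square 2) at 1 by lra. rewrite <- sqrt_mult by lra.
  apply sqrt_le_1; lra. }
assert (Hst : 0 < sqrt t) by (apply sqrt_lt_R0; lra).
set (q := (1 / (2 * sqrt_it t))%C).
assert (Hq : q = (/ (4 * r), - / (4 * r))).
{ unfold q. rewrite sqrt_it_pair. fold r. cbn. unfold Cdiv, Cmult, Cinv, RtoC; cbn [fst snd].
  f_equal; field; nra. }
assert (Hqq : forall v : R, Re (- (0 + v * q) ^ 2) = 0).
{ intros v. rewrite Hq. cbn. ring. }
assert (Hq1 : Cmod q <= / (2 * r)).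
{ eapply Rle_trans; [apply Cmod_2Rmax|].
  rewrite Hq; cbn [fst snd]. rewrite Rabs_Ropp, Rmax_left by lra.
  rewrite Rabs_pos_eq by (apply Rlt_le, Rinv_0_lt_compat; lra).
  replace (/ (2 * r)) with (2 * / (4 * r)) by (field; lra).
  apply Rmult_le_compat_r; [apply Rlt_le, Rinv_0_lt_compat; lra|].
  rewrite <- (sqrt_square 2) at 2 by lra. apply sqrt_le_1; lra. }
assert (E : forall v : R, wave_arg t 0 (v * a) = (0 + v * (a * q))%C).
{ intros v. unfold wave_arg, q. rewrite RtoC_mult. unfold Cdiv. ring. }
replace (wave t 0 a - 1)%C with (- (Cerf (0 + 1 * (a * q)) - Cerf (0 + 0 * (a * q))))%C.
2:{ unfold wave. replace (0 * a + Ci * 0 ^ 2 * t)%C with (RtoC 0) by ring.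
    rewrite Cexp_0. rewrite <- (Rmult_1_l a) at 3. rewrite E.
    replace (0 + 0 * (a * q))%C with (RtoC 0) by ring. rewrite Cerf_0. ring. }
rewrite Cmod_opp.
apply Rle_trans with (1 * (Rabs a / r) - 0 * (Rabs a / r)).
- apply (Cderive_increment_le (fun v => Cerf (0 + v * (a * q)))
    (fun v => a * q * Cerf' (0 + v * (a * q)))%C
    (fun v => v * (Rabs a / r)) (fun _ => Rabs a / r)).
  + lra.
  + intros v. apply is_Cderive_Cerf.
  + intros v. unfold Cerf'. Ccont.
  + intros v. auto_derive; [easy|simpl; ring].
  + intros v. apply continuous_const.
  + intros v _. rewrite !Cmod_mult, Cmod_R.
    assert (He : Cmod (Cerf' (0 + v * (a * q))) <= 2).
    { eapply Rle_trans; [apply Cmod_Cerf'|].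
      replace (0 + v * (a * q))%C with (0 + (v * a)%R * q)%C by (rewrite RtoC_mult; ring).
      rewrite Hqq, exp_0. lra. }
    replace (Rabs a / r) with (Rabs a * / (2 * r) * 2) by (field; lra).
    pose proof (Rabs_pos a). pose proof (Cmod_ge_0 q).
    apply Rmult_le_compat; auto using Cmod_ge_0.
    * apply Rmult_le_pos; lra.
    * apply Rmult_le_compat_l; lra.
- replace (1 * (Rabs a / r) - 0 * (Rabs a / r)) with (Rabs a * / r) by (unfold Rdiv; ring).
  replace (2 * Rabs a / sqrt t) with (Rabs a * (2 / sqrt t)) by (unfold Rdiv; ring).
  apply Rmult_le_compat_l; [apply Rabs_pos|].
  apply Rle_div_r; [lra|]. rewrite Rmult_comm. apply Rle_div_l; lra.
Qed.

(** * Integrals over half lines *)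

(** The chirps in the derivatives of the two waves cancel, and the choice
kappa = - i k makes the second wave times exp (i k y) contribute nothing else.
Allowing m = 0 covers the resonant value w = - i k. *)
Lemma is_Cderive_wave_primitive (t k : R) (m w : C) (c y : R) : 0 < t ->
  m = RtoC 0 \/ (w + Ci * k)%C <> RtoC 0 ->
  is_Cderive (fun y => m * ((wave t w (c + y) - wave t (- (Ci * k)) (c + y)) / (w + Ci * k))
                        * Cexp (Ci * k * y))%C y
    (m * wave t w (c + y) * Cexp (Ci * k * y))%C.
Proof.
intros Ht Hm. unfold Cdiv. eapply is_Cderive_val.
- apply is_Cderive_mult; [|Cderive].
  apply is_Cderive_mult; [Cderive|].
  apply is_Cderive_mult; [|Cderive].
  apply is_Cderive_minus; apply is_Cderive_wave; exact Ht.
- destruct Hm as [->|Hm]; [Cring|].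
  Cfield.
  split; [exact Hm|]. rewrite sqrt_ipit_eq by exact Ht. apply Cmult_neq_0.
  + now apply sqrt_it_neq_0.
  + apply RtoC_neq_0. destruct sqrt_PI_bounds; lra.
Qed.

(** For kappa = - i k the factor exp (i k y) cancels the exponential in front of
the wave, so that only the chirp is left in the derivative. *)
Lemma is_Cderive_chirp_primitive (t k : R) (m : C) (c y : R) : 0 < t ->
  is_Cderive (fun y => - (m / 2) * wave t (- (Ci * k)) (c + y) * Cexp (Ci * k * y))%C y
    (1 / (2 * sqrt_ipit t) * (m * chirp t (c + y)) * Cexp (Ci * k * y))%C.
Proof.
intros Ht. unfold Cdiv. eapply is_Cderive_val.
- apply is_Cderive_mult; [|Cderive].
  apply is_Cderive_mult; [Cderive|].
  apply is_Cderive_wave; exact Ht.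
- Cfield.
  rewrite sqrt_ipit_eq by exact Ht. apply Cmult_neq_0.
  + now apply sqrt_it_neq_0.
  + apply RtoC_neq_0. destruct sqrt_PI_bounds; lra.
Qed.

(** Fundamental theorem of calculus with a primitive vanishing at infinity. *)
Lemma is_RInt_gen_half_line (f F : R -> C) :
  (forall y, is_Cderive F y (f y)) -> (forall y, Ccontinuous f y) -> O_inv_sqrt F ->
  is_RInt_gen (V := C_R_NormedModule) f (at_point 0) (Rbar_locally p_infty) (- F 0)%C.
Proof.
intros Hd Hc HO P HP. apply O_inv_sqrt_filterlim in HO.
assert (HL : filterlim (fun y => F y - F 0 : C_R_NormedModule)%C
  (Rbar_locally p_infty) (locally (- F 0 : C_R_NormedModule)%C)).
{ replace (- F 0 : C_R_NormedModule)%C with (plus (zero : C_R_NormedModule) (opp (F 0)))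
    by apply (@plus_zero_l C_R_NormedModule).
  apply (filterlim_comp_2 (F := Rbar_locally p_infty) (fun y => F y : C_R_NormedModule)
    (fun _ => opp (F 0) : C_R_NormedModule) plus HO (filterlim_const _)).
  apply (filterlim_plus (V := C_R_NormedModule)). }
apply (Filter_prod _ _ _ (fun a => a = 0) (fun b => P (F b - F 0)%C)).
- reflexivity.
- apply HL, HP.
(* The integral up to b is F b - F 0, and F b tends to 0. *)
- intros a b -> Hb. exists (F b - F 0)%C. split; [|exact Hb].
  now apply is_RInt_Cderive.
Qed.

Lemma is_RInt_gen_reflect (f : R -> C) (l : C) :
  is_RInt_gen (V := C_R_NormedModule) (fun y => f (- y))
    (at_point 0) (Rbar_locally p_infty) l ->
  is_RInt_gen (V := C_R_NormedModule) f (Rbar_locally m_infty) (at_point 0) l.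
Proof.
intros H P HP. destruct (H P HP) as [Q S HQ [M HS] HQS].
apply (Filter_prod _ _ _ (fun a => S (- a)) (fun b => b = 0)).
- exists (- M). intros a Ha. apply HS. lra.
- reflexivity.
- intros a b Ha ->. destruct (HQS 0 (- a) HQ Ha) as (l' & Hl & HP').
  exists l'. split; [|exact HP'].
  cbn [fst snd] in *. apply is_RInt_swap in Hl.
  rewrite <- Ropp_0 in Hl at 1.
  apply (is_RInt_comp_opp (V := C_R_NormedModule)) in Hl.
  apply (is_RInt_opp (V := C_R_NormedModule)) in Hl. rewrite opp_opp in Hl.
  revert Hl. apply is_RInt_ext. intros y _. now rewrite opp_opp, Ropp_involutive.
Qed.

(** The integral of m wave t w (c + y) exp (i k y) over y >= 0. *)
Definition half_line_term (t k c : R) (w m : C) : C :=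
  (m * ((wave t (- (Ci * k)) c - wave t w c) / (w + Ci * k)))%C.

(** The shape that the integrand of Psi has on either half line. *)
Lemma is_RInt_gen_wave_chirp (t k c b : R) (w1 w2 m1 m2 m0 : C) : 0 < t ->
  m1 = RtoC 0 \/ (w1 + Ci * k)%C <> RtoC 0 ->
  m2 = RtoC 0 \/ (w2 + Ci * k)%C <> RtoC 0 ->
  is_RInt_gen (V := C_R_NormedModule)
    (fun y => ((m1 * wave t w1 (c + y) + m2 * wave t w2 (c + y))
       + 1 / (2 * sqrt_ipit t) * (m0 * chirp t (c + y) + chirp t (b + y)))
       * Cexp (Ci * k * y))%C
    (at_point 0) (Rbar_locally p_infty)
    (half_line_term t k c w1 m1 + half_line_term t k c w2 m2
     + m0 / 2 * wave t (- (Ci * k)) c + 1 / 2 * wave t (- (Ci * k)) b)%C.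
Proof.
intros Ht H1 H2.
set (K := (- (Ci * k))%C).
pose (prim := fun (m w : C) (y : R) =>
  (m * ((wave t w (c + y) - wave t K (c + y)) / (w + Ci * k)) * Cexp (Ci * k * y))%C).
pose (prim0 := fun (m : C) (a y : R) => (- (m / 2) * wave t K (a + y) * Cexp (Ci * k * y))%C).
pose (F := fun y : R => (prim m1 w1 y + prim m2 w2 y + prim0 m0 c y + prim0 1 b y)%C).
assert (HK : forall g : R -> C, O_inv_sqrt g ->
  O_inv_sqrt (fun y => Cexp (Ci * k * y) * g y)%C).
{ intros g. apply (O_inv_sqrt_mult_bounded g (fun y => Cexp (Ci * k * y)%C) 1).
  intros y. replace (Ci * k * y)%C with (Ci * (k * y)%R)%C by (rewrite RtoC_mult; ring).
  right. apply Cmod_Cexp_imaginary. }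
assert (HP : forall m w, O_inv_sqrt (prim m w)).
{ intros m w. apply (O_inv_sqrt_ext (fun y => Cexp (Ci * k * y) * (m / (w + Ci * k) *
    (wave t w (c + y) + -1 * wave t K (c + y))))%C).
  - intros y _. unfold prim, Cdiv. ring.
  - apply HK, O_inv_sqrt_scal, O_inv_sqrt_plus; [|apply O_inv_sqrt_scal];
      apply O_inv_sqrt_wave_space, Ht. }
assert (HP0 : forall m a, O_inv_sqrt (prim0 m a)).
{ intros m a. apply (O_inv_sqrt_ext (fun y => Cexp (Ci * k * y) *
    (- (m / 2) * wave t K (a + y)))%C).
  - intros y _. unfold prim0. ring.
  - apply HK, O_inv_sqrt_scal, O_inv_sqrt_wave_space, Ht. }
match goal with |- is_RInt_gen _ _ _ ?l => replace l with (- F 0)%C end.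
- apply is_RInt_gen_half_line.
  + intros y. unfold F. eapply is_Cderive_val.
    * apply is_Cderive_plus; [apply is_Cderive_plus; [apply is_Cderive_plus|]|].
      -- apply (is_Cderive_wave_primitive t k m1 w1 c y Ht H1).
      -- apply (is_Cderive_wave_primitive t k m2 w2 c y Ht H2).
      -- apply (is_Cderive_chirp_primitive t k m0 c y Ht).
      -- apply (is_Cderive_chirp_primitive t k 1 b y Ht).
    * Cring.
  + intros y. Ccont;
      [apply Ccontinuous_wave, Ht|apply Ccontinuous_wave, Ht
      |apply Ccontinuous_chirp|apply Ccontinuous_chirp].
  + unfold F. repeat apply O_inv_sqrt_plus; [apply HP|apply HP|apply HP0|apply HP0].
- unfold F, prim, prim0, half_line_term. fold K. rewrite !Rplus_0_r.
  replace (Ci * k * 0)%C with (RtoC 0) by ring. rewrite Cexp_0. unfold Cdiv. ring.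
Qed.

(** * The solution in closed form *)

(** What the integral formula and its asymptotics use of the coefficients: they
depend on y only through its sign, and mu_j vanishes with omega_j. *)
Record well_behaved (c : coefficients) : Prop := {
  wb_mu_pos : forall j x y, 0 < y -> mu c j x y = mu_0p c j x;
  wb_mu_neg : forall j x y, y < 0 -> mu c j x y = mu_0m c j x;
  wb_mu0_pos : forall x y, 0 < y -> mu0 c x y = mu0_0p c x;
  wb_mu0_neg : forall x y, y < 0 -> mu0 c x y = mu0_0m c x;
  wb_omega_0 : forall j x y, omega c j = 0 -> mu c j x y = RtoC 0
}.

Lemma Theta_scale (s x : R) : 0 < s -> Theta (s * x) = Theta x.
Proof.
intros Hs. unfold Theta. destruct (Rlt_dec 0 x), (Rlt_dec 0 (s * x)); auto; exfalso; nra.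
Qed.

Lemma sign_scale (s x : R) : 0 < s -> sign (s * x) = sign x.
Proof. intros Hs. rewrite sign_mult, (sign_eq_1 s Hs). ring. Qed.

Lemma eta_scale (alpha beta : C) (x y s : R) : 0 < s ->
  eta alpha beta x (s * y) = eta alpha beta x y.
Proof.
intros Hs. unfold eta.
destruct (Rlt_dec 0 y), (Rlt_dec 0 (s * y)); auto; exfalso; nra.
Qed.

(** Dependence on the sign of y only, expressed as invariance under positive
scalings. *)
Lemma coefs_scale (phi : R) (alpha beta : C) (s : R) : 0 < s ->
  (forall j x y, mu (coefs phi alpha beta) j x (s * y) = mu (coefs phi alpha beta) j x y) /\
  (forall x y, mu0 (coefs phi alpha beta) x (s * y) = mu0 (coefs phi alpha beta) x y).
Proof.
intros Hs.
assert (E : forall x y, x * (s * y) = s * (x * y)) by (intros; ring).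
assert (E' : forall x y, - (s * (x * y)) = s * - (x * y)) by (intros; ring).
unfold coefs. destruct Req_EM_T; [destruct Req_EM_T|]; split; intros; cbn;
  try destruct j; rewrite ?E, ?E', ?eta_scale, ?Theta_scale, ?sign_scale by exact Hs; reflexivity.
Qed.

(** In the second case mu_+ vanishes with cot phi; the angle is restricted so
that sin phi is nonzero there. *)
Lemma coefs_well_behaved (phi : R) (alpha beta : C) : 0 <= phi < PI ->
  well_behaved (coefs phi alpha beta).
Proof.
intros Hphi. split.
- intros j x y Hy. rewrite <- (Rmult_1_r y) at 1. now apply coefs_scale.
- intros j x y Hy. replace y with (- y * -1) by ring. apply coefs_scale. lra.
- intros x y Hy. rewrite <- (Rmult_1_r y) at 1. now apply coefs_scale.
- intros x y Hy. replace y with (- y * -1) by ring. apply coefs_scale. lra.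
- intros j x y. unfold coefs. destruct Req_EM_T; [destruct Req_EM_T|]; cbn.
  + reflexivity.
  + destruct j; [|reflexivity]. intros H.
    (* cos phi <> 1 excludes phi = 0. *)
    assert (Hs : 0 < sin phi).
    { apply sin_gt_0; [|lra]. destruct (proj1 Hphi) as [Hp|<-]; [exact Hp|].
      rewrite cos_0 in *. lra. }
    rewrite <- RtoC_div, H by lra. unfold Cdiv. ring.
  + intros H. rewrite H. unfold Cdiv. ring.
Qed.

Lemma chirp_even (t a : R) : chirp t (- a) = chirp t a.
Proof. unfold chirp. rewrite RtoC_opp. do 2 f_equal. unfold Cdiv. ring. Qed.

Lemma G_eq (c : coefficients) (t x y : R) : 0 < t ->
  G c t x y =
  ((mu c plus_br x y * wave t (omega c plus_br) (Rabs x + Rabs y)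
    + mu c minus_br x y * wave t (omega c minus_br) (Rabs x + Rabs y))
   + 1 / (2 * sqrt_ipit t)
     * (mu0 c x y * chirp t (Rabs x + Rabs y) + chirp t (x - y)))%C.
Proof.
intros Ht. rewrite !wave_Lambda by exact Ht. unfold G, chirp, wave_arg. cbv zeta.
rewrite (RtoC_minus x y). ring.
Qed.

(** The denominator omega_j + i k vanishes only if omega_j = 0, and then mu_j
vanishes too. *)
Lemma mu_0_or_denominator_neq_0 (c : coefficients) (Hc : well_behaved c) (j : branch) (x y k : R) :
  mu c j x y = RtoC 0 \/ (omega c j + Ci * k)%C <> RtoC 0.
Proof.
destruct (Req_EM_T (omega c j) 0) as [E|E]; [left; now apply Hc|right].
intros H. apply (f_equal Re) in H. cbn in H. lra.
Qed.

(** The part of the integral over the half line of sign s that depends on the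
point interaction; for s = -1 the frequency is reversed by y -> - y. *)
Definition side (c : coefficients) (t x s k : R) : C :=
  (half_line_term t k (Rabs x) (omega c plus_br) (mu c plus_br x s)
   + half_line_term t k (Rabs x) (omega c minus_br) (mu c minus_br x s)
   + mu0 c x s / 2 * wave t (- (Ci * k)) (Rabs x))%C.

Lemma is_RInt_gen_G_pos (c : coefficients) (F : R -> C) (t x k : R) :
  well_behaved c -> (forall y, F y = Cexp (Ci * k * y)) -> 0 < t ->
  is_RInt_gen (V := C_R_NormedModule) (fun y => G c t x y * F y)%C
    (at_point 0) (Rbar_locally p_infty)
    (side c t x 1 k + 1 / 2 * wave t (- (Ci * k)) (- x))%C.
Proof.
intros Hc HF Ht.
eapply is_RInt_gen_ext; [|apply (is_RInt_gen_wave_chirp t k (Rabs x) (- x)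
    (omega c plus_br) (omega c minus_br) (mu_0p c plus_br x) (mu_0p c minus_br x)
    (mu0_0p c x) Ht); apply (mu_0_or_denominator_neq_0 c Hc)].
apply (Filter_prod _ _ _ (fun a => a = 0) (fun b => 0 < b)).
- reflexivity.
- now exists 0.
- intros a b -> Hb y. cbn [fst snd]. rewrite Rmin_left, Rmax_right by lra.
  intros [Hy _]. rewrite G_eq, HF by exact Ht.
  rewrite !(wb_mu_pos c Hc), (wb_mu0_pos c Hc) by exact Hy.
  rewrite (Rabs_pos_eq y) by lra.
  replace (x - y) with (- (- x + y)) by ring. now rewrite chirp_even.
Qed.

(** The reflection y -> - y maps this to the positive half line with k replaced
by - k and x - y by x + y. *)
Lemma is_RInt_gen_G_neg (c : coefficients) (F : R -> C) (t x k : R) :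
  well_behaved c -> (forall y, F y = Cexp (Ci * k * y)) -> 0 < t ->
  is_RInt_gen (V := C_R_NormedModule) (fun y => G c t x y * F y)%C
    (Rbar_locally m_infty) (at_point 0)
    (side c t x (-1) (- k) + 1 / 2 * wave t (- (Ci * (- k)%R)) x)%C.
Proof.
intros Hc HF Ht.
apply is_RInt_gen_reflect.
eapply is_RInt_gen_ext; [|apply (is_RInt_gen_wave_chirp t (- k) (Rabs x) x
    (omega c plus_br) (omega c minus_br) (mu_0m c plus_br x) (mu_0m c minus_br x)
    (mu0_0m c x) Ht); apply (mu_0_or_denominator_neq_0 c Hc)].
apply (Filter_prod _ _ _ (fun a => a = 0) (fun b => 0 < b)).
- reflexivity.
- now exists 0.
- intros a b -> Hb y. cbn [fst snd]. rewrite Rmin_left, Rmax_right by lra.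
  intros [Hy _]. rewrite G_eq, HF by exact Ht.
  rewrite !(wb_mu_neg c Hc), (wb_mu0_neg c Hc) by lra.
  rewrite Rabs_Ropp, (Rabs_pos_eq y) by lra.
  replace (x - - y) with (x + y) by ring.
  replace (Ci * k * (- y)%R)%C with (Ci * (- k)%R * y)%C by (rewrite !RtoC_opp; ring).
  reflexivity.
Qed.

Lemma ex_Psi_plane_wave (c : coefficients) (F : R -> C) (t x k : R) :
  well_behaved c -> (forall y, F y = Cexp (Ci * k * y)) -> 0 < t -> ex_Psi c F t x.
Proof.
intros Hc HF Ht. split; eexists;
  [apply (is_RInt_gen_G_neg c F t x k)|apply (is_RInt_gen_G_pos c F t x k)]; assumption.
Qed.

(** The two waves left over from the free chirp are wave t (- i k) (- x) and
wave t (i k) x, whose half sum is the freely evolving plane wave. *)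
Lemma Psi_plane_wave (c : coefficients) (F : R -> C) (t x k : R) :
  well_behaved c -> (forall y, F y = Cexp (Ci * k * y)) -> 0 < t ->
  Psi c F t x = (Cexp (Ci * k * x - Ci * k ^ 2 * t)
    + side c t x 1 k + side c t x (-1) (- k))%C.
Proof.
intros Hc HF Ht.
unfold Psi.
rewrite (is_RInt_gen_unique (V := C_R_CompleteNormedModule) _ _
  (is_RInt_gen_G_neg c F t x k Hc HF Ht)).
rewrite (is_RInt_gen_unique (V := C_R_CompleteNormedModule) _ _
  (is_RInt_gen_G_pos c F t x k Hc HF Ht)).
assert (E := wave_reflect t (Ci * k) x).
replace (Ci * k * x + Ci * (Ci * k) ^ 2 * t)%C
  with (Ci * k * x - Ci * k ^ 2 * t)%C in E.
2:{ replace ((Ci * k) ^ 2)%C with ((Ci * Ci) * k ^ 2)%C by ring. rewrite Ci_sqr. ring. }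
replace (- (Ci * (- k)%R))%C with (Ci * k)%C by (rewrite RtoC_opp; ring).
transitivity (1 / 2 * (wave t (Ci * k) x + wave t (- (Ci * k)) (- x))
  + side c t x 1 k + side c t x (-1) (- k))%C; [ring|].
rewrite E. field.
Qed.

(** * Long time asymptotics *)

Lemma O_inv_sqrt_wave_real (w a : R) : w <> 0 ->
  O_inv_sqrt (fun t => wave t w a
    - 2 * Theta (- w) * Cexp (w * a + Ci * w ^ 2 * t))%C.
Proof.
intros Hw. unfold Theta. destruct (Rlt_dec 0 (- w)).
- apply (O_inv_sqrt_ext (fun t => wave t w a - 2 * Cexp (w * a + Ci * w ^ 2 * t))%C).
  { intros t _. ring. }
  apply O_inv_sqrt_wave_residue. cbn. lra.
- apply (O_inv_sqrt_ext (fun t => wave t w a)).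
  { intros t _. ring. }
  apply O_inv_sqrt_wave_time. cbn. lra.
Qed.

(** The term of branch j with its waves replaced by their limits; L is the limit
of wave t (- i k) |x|. *)
Definition branch_limit (c : coefficients) (x s k : R) (L : R -> C) (j : branch) (t : R) : C :=
  (mu c j x s * ((L t - 2 * Theta (- omega c j)
     * Cexp (omega c j * Rabs x + Ci * omega c j ^ 2 * t)) / (omega c j + Ci * k)))%C.

Definition side_limit (c : coefficients) (x s k : R) (L : R -> C) (t : R) : C :=
  (sum_pm (fun j => branch_limit c x s k L j t) + mu0 c x s / 2 * L t)%C.

Lemma side_asymptotics (c : coefficients) (x s k : R) (L : R -> C) :
  well_behaved c ->
  O_inv_sqrt (fun t => wave t (- (Ci * k)) (Rabs x) - L t)%C ->
  O_inv_sqrt (fun t => side c t x s k - side_limit c x s k L t)%C.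
Proof.
intros Hc HL.
assert (Hj : forall j, O_inv_sqrt (fun t =>
  half_line_term t k (Rabs x) (omega c j) (mu c j x s) - branch_limit c x s k L j t)%C).
{ intros j. destruct (Req_EM_T (omega c j) 0) as [E|E].
  - apply (O_inv_sqrt_ext (fun t => 0 * (wave t (- (Ci * k)) (Rabs x) - L t))%C).
    + intros t _. unfold half_line_term, branch_limit.
      rewrite (wb_omega_0 c Hc j x s E). ring.
    + now apply O_inv_sqrt_scal.
  - apply (O_inv_sqrt_ext (fun t => mu c j x s * / (omega c j + Ci * k) *
      ((wave t (- (Ci * k)) (Rabs x) - L t) + -1 * (wave t (omega c j) (Rabs x)
       - 2 * Theta (- omega c j) * Cexp (omega c j * Rabs x + Ci * omega c j ^ 2 * t))))%C).
    + intros t _. unfold half_line_term, branch_limit, Cdiv. ring.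
    + apply O_inv_sqrt_scal, O_inv_sqrt_plus; [exact HL|].
      apply O_inv_sqrt_scal, O_inv_sqrt_wave_real, E. }
apply (O_inv_sqrt_ext (fun t =>
  (half_line_term t k (Rabs x) (omega c plus_br) (mu c plus_br x s)
     - branch_limit c x s k L plus_br t)
  + (half_line_term t k (Rabs x) (omega c minus_br) (mu c minus_br x s)
     - branch_limit c x s k L minus_br t)
  + mu0 c x s / 2 * (wave t (- (Ci * k)) (Rabs x) - L t))%C).
- intros t _. unfold side, side_limit, sum_pm. ring.
- apply O_inv_sqrt_plus; [apply O_inv_sqrt_plus; apply Hj|now apply O_inv_sqrt_scal].
Qed.

(** The limits Lp and Lm are parameters because they depend on the sign of k. *)
Lemma Psi_asymptotics (c : coefficients) (F : R -> C) (x k : R) (Lp Lm : R -> C) :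
  well_behaved c -> (forall y, F y = Cexp (Ci * k * y)) ->
  O_inv_sqrt (fun t => wave t (- (Ci * k)) (Rabs x) - Lp t)%C ->
  O_inv_sqrt (fun t => wave t (Ci * k) (Rabs x) - Lm t)%C ->
  O_inv_sqrt (fun t => Psi c F t x - (Cexp (Ci * k * x - Ci * k ^ 2 * t)
    + side_limit c x 1 k Lp t + side_limit c x (-1) (- k) Lm t))%C.
Proof.
intros Hc HF Hp Hm.
replace (Ci * k)%C with (- (Ci * (- k)%R))%C in Hm by (rewrite RtoC_opp; ring).
apply (O_inv_sqrt_ext (fun t =>
  (side c t x 1 k - side_limit c x 1 k Lp t)
  + (side c t x (-1) (- k) - side_limit c x (-1) (- k) Lm t))%C).
- intros t Ht. rewrite (Psi_plane_wave c F t x k Hc HF Ht). ring.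
- apply O_inv_sqrt_plus; now apply side_asymptotics.
Qed.

Lemma wave_imaginary_decay (k a : R) : k < 0 ->
  O_inv_sqrt (fun t => wave t (Ci * k) a - 0)%C.
Proof.
intros Hk. apply (O_inv_sqrt_ext (fun t => wave t (Ci * k) a)).
- intros t _. ring.
- apply O_inv_sqrt_wave_time. cbn. lra.
Qed.

Lemma wave_imaginary_residue (k a : R) : 0 < k ->
  O_inv_sqrt (fun t => wave t (Ci * k) a - 2 * Cexp (Ci * (k * a)%R - Ci * k ^ 2 * t))%C.
Proof.
intros Hk.
apply (O_inv_sqrt_ext (fun t => wave t (Ci * k) a
  - 2 * Cexp (Ci * k * a + Ci * (Ci * k) ^ 2 * t))%C).
- intros t _.
  replace (Ci * (k * a)%R - Ci * k ^ 2 * t)%C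
    with (Ci * k * a + Ci * (Ci * k) ^ 2 * t)%C; [reflexivity|].
  replace ((Ci * k) ^ 2)%C with ((Ci * Ci) * k ^ 2)%C by ring.
  rewrite Ci_sqr, RtoC_mult. ring.
- apply O_inv_sqrt_wave_residue. cbn. lra.
Qed.

(** Since mu_j vanishes with omega_j, the convention for quotients by
omega_j = 0 agrees with multiplication by any value of the inverse. *)
Lemma quot0_well_behaved (c : coefficients) (j : branch) (x y y' : R) : well_behaved c ->
  quot0 (mu c j x y + mu c j x y') (omega c j)
  = ((mu c j x y + mu c j x y') * / omega c j)%C.
Proof.
intros Hc. unfold quot0. destruct Req_EM_T as [E|E]; [|reflexivity].
rewrite !(wb_omega_0 c Hc j _ _ E). ring.
Qed.

Theorem theorem5p4 (J : @matrix C 2 2) (HJ : unitary J)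
    (phi : R) (alpha beta : C) (Hpar : parametrizes phi alpha beta J) :
  let c := coefs phi alpha beta in
  (forall k : R, k <> 0 ->
     let F := fun y : R => Cexp (Ci * k * y) in
     forall x : R, x <> 0 ->
       (forall t : R, 0 < t -> ex_Psi c F t x) /\
       O_inv_sqrt (fun t : R =>
         (Psi c F t x -
          (Cexp (Ci * k * x - Ci * k ^ 2 * t)
           + 2 * (mu c plus_br x (- k)%R / (omega c plus_br - Ci * Rabs k)
                  + mu c minus_br x (- k)%R / (omega c minus_br - Ci * Rabs k)
                  + mu0 c x (- k)%R / 2)
               * Cexp (Ci * Rabs (k * x) - Ci * k ^ 2 * t)
           - sum_pm (fun j =>
               (mu_0m c j x / (omega c j - Ci * k)
                + mu_0p c j x / (omega c j + Ci * k))
               * (2 * Theta (- omega c j))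
               * Cexp (omega c j * Rabs x + Ci * omega c j ^ 2 * t))))%C))
  /\
  (let F := fun _ : R => RtoC 1 in
   forall x : R, x <> 0 ->
     (forall t : R, 0 < t -> ex_Psi c F t x) /\
     O_inv_sqrt (fun t : R =>
       (Psi c F t x -
        (quot0 (mu_0p c plus_br x + mu_0m c plus_br x) (omega c plus_br)
         + quot0 (mu_0p c minus_br x + mu_0m c minus_br x) (omega c minus_br)
         + (mu0_0p c x + mu0_0m c x) / 2
         + 1
         - sum_pm (fun j =>
             quot0 (mu_0m c j x + mu_0p c j x) (omega c j)
             * (2 * Theta (- omega c j))
             * Cexp (omega c j * Rabs x + Ci * omega c j ^ 2 * t))))%C)).
Proof.
intros c.
assert (Hc : well_behaved c) by (apply coefs_well_behaved, Hpar).
clearbody c. split.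
- intros k Hk F x _.
  assert (HF : forall y, F y = Cexp (Ci * k * y)) by reflexivity.
  split; [intros t Ht; now apply (ex_Psi_plane_wave c F t x k)|].
  assert (Em : forall j, (omega c j + Ci * (- k)%R)%C = (omega c j - Ci * k)%C).
  { intros j. rewrite RtoC_opp. ring. }
  destruct (Rlt_dec 0 k) as [Hk'|Hk'].
  (* For k > 0 the half line y < 0 supplies the outgoing plane wave. *)
  + eapply O_inv_sqrt_ext; [|apply (Psi_asymptotics c F x k (fun _ => 0)
      (fun t => 2 * Cexp (Ci * (k * Rabs x)%R - Ci * k ^ 2 * t))%C Hc HF)].
    * intros t _. cbv beta. unfold side_limit, branch_limit, sum_pm.
      rewrite !Em, !(wb_mu_neg c Hc _ x (- k)), (wb_mu0_neg c Hc x (- k)) by lra.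
      rewrite Rabs_mult, (Rabs_pos_eq k) by lra.
      unfold mu_0p, mu_0m, mu0_0m, Cdiv.
      ring.
    * replace (- (Ci * k))%C with (Ci * (- k)%R)%C by (rewrite RtoC_opp; ring).
      apply wave_imaginary_decay. lra.
    * now apply wave_imaginary_residue.
  (* For k < 0 it comes from the half line y > 0. *)
  + eapply O_inv_sqrt_ext; [|apply (Psi_asymptotics c F x k
      (fun t => 2 * Cexp (Ci * (- k * Rabs x)%R - Ci * k ^ 2 * t))%C (fun _ => 0) Hc HF)].
    * intros t _. cbv beta. unfold side_limit, branch_limit, sum_pm.
      rewrite !Em, !(wb_mu_pos c Hc _ x (- k)), (wb_mu0_pos c Hc x (- k)) by lra.
      rewrite Rabs_mult, (Rabs_left k) by lra.
      replace (omega c plus_br - Ci * (- k)%R)%C with (omega c plus_br + Ci * k)%C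
        by (rewrite RtoC_opp; ring).
      replace (omega c minus_br - Ci * (- k)%R)%C with (omega c minus_br + Ci * k)%C
        by (rewrite RtoC_opp; ring).
      unfold mu_0p, mu_0m, mu0_0p, Cdiv.
      ring.
    * replace (- (Ci * k))%C with (Ci * (- k)%R)%C by (rewrite RtoC_opp; ring).
      apply (O_inv_sqrt_ext (fun t => wave t (Ci * (- k)%R) (Rabs x)
        - 2 * Cexp (Ci * (- k * Rabs x)%R - Ci * (- k)%R ^ 2 * t))%C).
      { intros t _. replace ((- k)%R ^ 2)%C with (k ^ 2)%C by (rewrite RtoC_opp; ring).
        reflexivity. }
      apply wave_imaginary_residue. lra.
    * apply wave_imaginary_decay. lra.
- intros F x _.
  assert (HF : forall y, F y = Cexp (Ci * 0 * y)).
  { intros y. replace (Ci * 0 * y)%C with (RtoC 0) by ring. now rewrite Cexp_0. }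
  split; [intros t Ht; now apply (ex_Psi_plane_wave c F t x 0)|].
  eapply O_inv_sqrt_ext; [|apply (Psi_asymptotics c F x 0 (fun _ => RtoC 1) (fun _ => RtoC 1) Hc HF)].
  + intros t _. cbv beta. unfold side_limit, branch_limit, sum_pm, mu_0p, mu_0m, mu0_0p, mu0_0m.
    rewrite !(quot0_well_behaved c _ x _ _ Hc).
    replace (Ci * 0 * x - Ci * 0 ^ 2 * t)%C with (RtoC 0) by ring. rewrite Cexp_0.
    rewrite Ropp_0.
    replace (omega c plus_br + Ci * 0)%C with (RtoC (omega c plus_br)) by ring.
    replace (omega c minus_br + Ci * 0)%C with (RtoC (omega c minus_br)) by ring.
    unfold Cdiv. ring.
  + replace (- (Ci * 0))%C with (RtoC 0) by ring. apply O_inv_sqrt_wave_0.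
  + replace (Ci * 0)%C with (RtoC 0) by ring. apply O_inv_sqrt_wave_0.
Qed.
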